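(* Let $Y\sim\mathrm{GMN}_d(\xi,\Sigma,\gamma,H)$ where the distribution $H$ of $(R,S)$ is absolutely continuous with density $h(r,s)$ on $\mathbb{R}\times\mathbb{R}_+$. Let $Y,\xi,\gamma,\Sigma$ be partitioned into blocks of sizes $d_1,d_2$, $d_1+d_2=d$, as $$Y=\begin{pmatrix}Y_1\\ Y_2\end{pmatrix},\quad \xi=\begin{pmatrix}\xi_1\\ \xi_2\end{pmatrix},\quad \gamma=\begin{pmatrix}\gamma_1\\ \gamma_2\end{pmatrix},\quad \Sigma=\begin{pmatrix}\Sigma_{11}&\Sigma_{12}\\ \Sigma_{21}&\Sigma_{22}\end{pmatrix}.$$ For $y_2\in\mathbb{R}^{d_2}$ set $$\xi_{1|2}=\xi_1+\Sigma_{12}\Sigma_{22}^{-1}(y_2-\xi_2),\quad \gamma_{1|2}=\gamma_1-\Sigma_{12}\Sigma_{22}^{-1}\gamma_2,\quad \Sigma_{11|2}=\Sigma_{11}-\Sigma_{12}\Sigma_{22}^{-1}\Sigma_{21},$$ let $f_2$ be the marginal density of $Y_2$, $f_2(y_2)=\int_{\mathbb{R}\times\mathbb{R}_+}\varphi_{d_2}(y_2;\xi_2+r\gamma_2,s^2\Sigma_{22})\,h(r,s)\,dr\,ds$, and let $$h_c(r,s\mid y_2)=\frac{\varphi_{d_2}(y_2;\xi_2+r\gamma_2,s^2\Sigma_{22})\,h(r,s)}{f_2(y_2)},$$ with $H_{c(y_2)}$ the distribution function with density $h_c(\cdot,\cdot\mid y_2)$. Then, for almost every $y_2$, the conditional distribution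 of $Y_1$ given $Y_2=y_2$ has density $$f_{1|2}(y_1\mid y_2)=\int_{\mathbb{R}\times\mathbb{R}_+}\varphi_{d_1}(y_1;\xi_{1|2}+r\,\gamma_{1|2},s^2\Sigma_{11|2})\,h_c(r,s\mid y_2)\,dr\,ds,$$ and hence $$(Y_1\mid Y_2=y_2)\sim\mathrm{GMN}_{d_1}\left(\xi_{1|2},\Sigma_{11|2},\gamma_{1|2},H_{c(y_2)}\right).$$
   Context: Generalized mixtures of normals (GMN). Let $\Sigma$ be a $d\times d$ symmetric positive definite matrix and $\xi,\gamma\in\mathbb{R}^d$. Let $X\sim\mathrm{N}_d(0,\Sigma)$ be a $d$-dimensional normal variable and $U,V$ univariate random variables such that $X,U,V$ are mutually independent. Let $r(u,v)$ be a real-valued function and $s(u,v)$ a positive-valued function, and let $R=r(U,V)$, $S=s(U,V)$ be the resulting random variables, so that $(R,S)$ is independent of $X$. Denote by $H$ the joint distribution (function) of $(R,S)$. If $Y=\xi+R\,\gamma+S\,X$, one writes $Y\sim\mathrm{GMN}_d(\xi,\Sigma,\gamma,H)$; this notation identifies the distribution of $Y$. $\varphi_k(x;\mu,\Lambda)$ denotes the density at $x\in\mathbb{R}^k$ of the normal distribution $\mathrm{N}_k(\mu,\Lambda)$. *)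

(* Defs.v *)
From HB Require Import structures.
From mathcomp Require Import all_boot all_order all_algebra.
From mathcomp Require Import all_classical all_reals all_analysis.
From mathcomp Require Import measurable_realfun.
Import Order.TTheory GRing.Theory Num.Theory.
Import numFieldNormedType.Exports.

Set Implicit Arguments.
Unset Strict Implicit.
Unset Printing Implicit Defensive.

Local Open Scope classical_set_scope.
Local Open Scope ring_scope.

Definition measure_cV_display : measure_display.
Proof. exact: default_measure_display. Qed.

(* Column vectors carry the sigma-algebra generated by the coordinates, i.e.,
   the Borel sigma-algebra of R^n. *)
Section measurable_cV.
Context {R : realType} (n : nat).

Let coors : 'I_n -> 'cV[R]_n -> measurableTypeR R := fun i x => x i 0.

Let cV_set0 : g_sigma_preimage coors set0.
Proof. exact: sigma_algebra0. Qed.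

Let cV_setC A : g_sigma_preimage coors A -> g_sigma_preimage coors (~` A).
Proof. exact: sigma_algebraC. Qed.

Let cV_bigcup (F : _^nat) : (forall i, g_sigma_preimage coors (F i)) ->
  g_sigma_preimage coors (\bigcup_i (F i)).
Proof. exact: sigma_algebra_bigcup. Qed.

HB.instance Definition _ := @isMeasurable.Build measure_cV_display
  'cV[R]_n (g_sigma_preimage coors) cV_set0 cV_setC cV_bigcup.

Lemma measurable_cV_coor (i : 'I_n) :
  measurable_fun [set: 'cV[R]_n] (fun x => x i 0).
Proof.
move=> _ Y mY; rewrite setTI; apply: sub_sigma_algebra => /=.
rewrite -bigcup_seq/=; exists i => //=; first by rewrite mem_index_enum.
by exists Y => //; rewrite setTI.
Qed.

Lemma measurable_fun_cVP d (T : measurableType d) (f : T -> 'cV[R]_n) :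
  measurable_fun setT f <-> forall i, measurable_fun setT (fun t => f t i 0).
Proof.
split=> [mf i|mf].
  exact: (measurableT_comp (measurable_cV_coor i) mf).
apply: (@measurability _ _ _ _ setT f
  (\big[setU/set0]_(i < n) preimage_set_system setT (coors i) measurable)) => //.
move=> _ [B + <-]; rewrite -bigcup_seq => -[i _ [C mC <-]].
by rewrite !setTI -[X in measurable X]setTI; exact: (mf i).
Qed.

End measurable_cV.

Section block_measurability.
Context {R : realType} (m n : nat).

Lemma measurable_usubmx :
  measurable_fun setT (@usubmx R m n 1 : 'cV[R]_(m + n) -> 'cV[R]_m).
Proof.
apply/measurable_fun_cVP => i; under eq_fun do rewrite mxE.
exact: measurable_cV_coor.
Qed.

Lemma measurable_dsubmx :
  measurable_fun setT (@dsubmx R m n 1 : 'cV[R]_(m + n) -> 'cV[R]_n).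
Proof.
apply/measurable_fun_cVP => i; under eq_fun do rewrite mxE.
exact: measurable_cV_coor.
Qed.

HB.instance Definition _ :=
  isMeasurableFun.Build _ _ _ _ (@usubmx R m n 1) measurable_usubmx.
HB.instance Definition _ :=
  isMeasurableFun.Build _ _ _ _ (@dsubmx R m n 1) measurable_dsubmx.

End block_measurability.

Section lebesgue_cV.
Context {R : realType}.
Local Open Scope ereal_scope.

Definition cons_cV n (p : R * 'cV[R]_n) : 'cV[R]_n.+1 := col_mx p.1%:M p.2.

(* Lebesgue measure on R^n; on R^0 it is the unit mass at the only point. *)
Fixpoint lebesgue_cV n : set 'cV[R]_n -> \bar R :=
  if n is n'.+1 then
    pushforward (@lebesgue_measure R \x @lebesgue_cV n') (@cons_cV n')
  else \d_ (0%R : 'cV[R]_0).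

Lemma measurable_cons_cV n :
  measurable_fun [set: measurableTypeR R * 'cV[R]_n] (@cons_cV n).
Proof.
apply/measurable_fun_cVP => i; rewrite /cons_cV.
under eq_fun do rewrite mxE.
case: split_ordP => j _.
  under eq_fun do rewrite ord1 mxE eqxx mulr1n.
  exact: measurable_fst.
exact: (measurableT_comp (measurable_cV_coor j)).
Qed.

Let uncons_cV n (x : 'cV[R]_n.+1) : measurableTypeR R * 'cV[R]_n :=
  (@usubmx R 1 n 1 x 0%R 0%R, @dsubmx R 1 n 1 x).

Let cons_cVK n (p : R * 'cV[R]_n) : uncons_cV (cons_cV p) = p.
Proof.
by case: p => a v; rewrite /uncons_cV/= col_mxKu col_mxKd mxE eqxx mulr1n.
Qed.

Let measurable_uncons_cV n : measurable_fun setT (@uncons_cV n).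
Proof.
apply/measurable_fun_pairP; split; last exact: (@measurable_dsubmx R 1 n).
exact: (measurableT_comp (measurable_cV_coor _) (@measurable_usubmx R 1 n)).
Qed.

Lemma lebesgue_cV_is_measure n :
  exists mu : {sigma_finite_measure set 'cV[R]_n -> \bar R},
    @lebesgue_cV n = mu.
Proof.
elim: n => [|n [mu IH]]; first by exists (\d_ (0%R : 'cV[R]_0)).
pose nu : {measure set (measurableTypeR R * 'cV[R]_n)%type -> \bar R} :=
  (@lebesgue_measure R \x mu).
have mC := @measurable_cons_cV n.
pose rho : {measure set 'cV[R]_n.+1 -> \bar R} :=
  pushforward nu (@cons_cV n).
have sf : sigma_finite setT (rho mC).
  have /sigma_finiteP[F [TF ndF Foo]] := sigma_finiteT (@lebesgue_measure R).
  have /sigma_finiteP[G [TG ndG Goo]] := sigma_finiteT mu.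
  exists (fun i => @uncons_cV n @^-1` (F i `*` G i)).
    rewrite -preimage_bigcup (_ : \bigcup_i _ = setT) ?preimage_setT//.
    rewrite -subTset => -[a b] _.
    have [i _ Fia] : (\bigcup_i F i) a by rewrite -TF.
    have [j _ Gjb] : (\bigcup_i G i) b by rewrite -TG.
    exists (maxn i j) => //; split => /=.
      by move: a Fia; exact/subsetPset/ndF/leq_maxl.
    by move: b Gjb; exact/subsetPset/ndG/leq_maxr.
  move=> i; have [mF Fi] := Foo i; have [mG Gi] := Goo i; split.
    rewrite -[X in measurable X]setTI; apply: measurable_uncons_cV => //.
    exact: measurableX.
  rewrite /rho /= /pushforward -comp_preimage (_ : _ \o _ = id); last first.
    by apply/funext => p; exact: cons_cVK.
  rewrite /nu preimage_id/= product_measure1E//.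
  by rewrite lte_mul_pinfty// ge0_fin_numE.
pose M := Measure_isSigmaFinite.Build _ _ _ (Measure.sort (rho mC)) sf.
pose tau : {sigma_finite_measure set 'cV[R]_n.+1 -> \bar R} :=
  HB.pack (Measure.sort (rho mC)) M.
by exists tau; rewrite /= IH.
Qed.

Section lebesgue_cV_measure.
Variable n : nat.

Let lebesgue_cV0 : @lebesgue_cV n set0 = 0.
Proof. by have [mu ->] := lebesgue_cV_is_measure n; exact: measure0. Qed.

Let lebesgue_cV_ge0 A : 0 <= @lebesgue_cV n A.
Proof. by have [mu ->] := lebesgue_cV_is_measure n; exact: measure_ge0. Qed.

Let lebesgue_cV_sigma_additive : semi_sigma_additive (@lebesgue_cV n).
Proof.
by have [mu ->] := lebesgue_cV_is_measure n; exact: measure_semi_sigma_additive.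
Qed.

HB.instance Definition _ := isMeasure.Build _ _ _ (@lebesgue_cV n)
  lebesgue_cV0 lebesgue_cV_ge0 lebesgue_cV_sigma_additive.

Let lebesgue_cV_sigma_finite : sigma_finite setT (@lebesgue_cV n).
Proof. by have [mu ->] := lebesgue_cV_is_measure n; exact: sigma_finiteT. Qed.

HB.instance Definition _ := Measure_isSigmaFinite.Build _ _ _ (@lebesgue_cV n)
  lebesgue_cV_sigma_finite.

End lebesgue_cV_measure.

End lebesgue_cV.
Arguments lebesgue_cV {R} n.

Definition density_measure d (T : measurableType d) (R : realType)
    (mu : set T -> \bar R) (D : set T) (f : T -> \bar R) : set T -> \bar R :=
  fun A => (\int[mu]_(x in A `&` D) f x)%E.

(* D carries all the mass of nu; the values of f outside D are irrelevant. *)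
Definition has_density d (T : measurableType d) (R : realType)
    (mu : set T -> \bar R) (D : set T) (f : T -> \bar R)
    (nu : set T -> \bar R) : Prop :=
  [/\ measurable_fun D f, (forall x, D x -> (0 <= f x)%E) &
      forall A, measurable A -> nu A = density_measure mu D f A].

Definition posdefmx (R : realType) n (S : 'M[R]_n) : Prop :=
  S^T = S /\ forall x : 'cV[R]_n, x != 0 -> 0 < (x^T *m S *m x) 0 0.

(* S is the covariance matrix, assumed positive definite. *)
Definition mvnormal_pdf (R : realType) n (m : 'cV[R]_n) (S : 'M[R]_n)
    (x : 'cV[R]_n) : R :=
  (Num.sqrt ((2 * pi) ^+ n * \det S))^-1 *
  expR (- 2^-1 * ((x - m)^T *m invmx S *m (x - m)) 0 0).

(* The subfamilies of {X, U, V} are covered by taking some of the sets to be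
   the whole space. *)
Definition mutually_independent3 d d1 d2 d3 (T : measurableType d)
    (T1 : measurableType d1) (T2 : measurableType d2) (T3 : measurableType d3)
    (R : realType) (P : probability T R)
    (X : {RV P >-> T1}) (U : {RV P >-> T2}) (V : {RV P >-> T3}) : Prop :=
  forall A B C, measurable A -> measurable B -> measurable C ->
    P (X @^-1` A `&` U @^-1` B `&` V @^-1` C) =
    (P (X @^-1` A) * P (U @^-1` B) * P (V @^-1` C))%E.

(* [is_GMN xi Sigma gamma H nu]: the law nu on R^n is GMN_n(xi, Sigma, gamma, H),
   where H is the joint law of (R, S).  The probability space carrying X, U, V
   is existentially quantified because the notation identifies a distribution,
   not a random variable. *)
Definition is_GMN (R : realType) n (xi : 'cV[R]_n) (Sigma : 'M[R]_n)
    (gamma : 'cV[R]_n) (H : set (R * R) -> \bar R)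
    (nu : set 'cV[R]_n -> \bar R) : Prop :=
  posdefmx Sigma /\
  exists (d : measure_display) (T : measurableType d) (P : probability T R)
    (X : {RV P >-> 'cV[R]_n}) (U V : {RV P >-> R})
    (r s : {mfun (R * R)%type >-> R}),
    [/\ has_density (lebesgue_cV n) setT
          (fun x => (mvnormal_pdf 0 Sigma x)%:E) (distribution P X),
        mutually_independent3 X U V,
        forall u v, 0 < s (u, v),
        forall A, measurable A ->
          H A = P [set t | A (r (U t, V t), s (U t, V t))] &
        forall B, measurable B ->
          nu B = P [set t | B (xi + r (U t, V t) *: gamma
                                  + s (U t, V t) *: X t)]].

Section conditional_distribution.
Context d d1 d2 (T : measurableType d) (T1 : measurableType d1)
  (T2 : measurableType d2) (R : realType) (P : probability T R).

(* Q y2 is (a version of) the conditional distribution of Y1 given Y2 = y2 *)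
Definition is_conditional_distribution (Y1 : {RV P >-> T1})
    (Y2 : {RV P >-> T2}) (Q : R.-pker T2 ~> T1) : Prop :=
  forall A B, measurable A -> measurable B ->
    P (Y1 @^-1` A `&` Y2 @^-1` B) =
    (\int[distribution P Y2]_(y in B) Q y A)%E.

End conditional_distribution.

(* Main.v *)
Require Import Defs.
From HB Require Import structures.
From mathcomp Require Import all_boot all_order all_algebra.
From mathcomp Require Import all_classical all_reals all_analysis.
From mathcomp Require Import measurable_realfun.
From mathcomp Require Import lra.
Import Order.TTheory GRing.Theory Num.Theory.
Import numFieldNormedType.Exports.

Set Implicit Arguments.
Unset Strict Implicit.
Unset Printing Implicit Defensive.

Local Open Scope classical_set_scope.
Local Open Scope ring_scope.

(** Given (R, S) = p, the vector Y is normal with mean xi + p.1 gamma and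
    covariance p.2 ^ 2 Sigma, so that Y has a density, the mixture over p of
    these normal densities with weight h p ([gmn_law], [is_GMN_density]). Each
    normal density factors as the marginal density of the second block times the
    conditional density of the first one ([mvnormal_pdf_block]). When Sigma is
    multiplied by p.2 ^ 2, the regression coefficients Sigma12 Sigma22^-1 do not
    change and the Schur complement is multiplied by p.2 ^ 2, so that the
    conditional mean is affine in p.1 and the conditional covariance
    proportional to p.2 ^ 2 ([gmn_pdf_block]): each conditional component has
    the form required by a mixture. Integrating the first block out leaves the
    mixture f2, which is the density of Y2 ([gmn_mix_marginal]), and dividing
    the joint density by f2 moves the factor depending on the second block into
    the mixing density, which becomes hc ([gmn_mix_conditional]).

    The normalized slices of a joint density are a version of the conditional
    distribution ([conditional_density]). Any other version agrees with it for
    almost every y2, because the Borel sets of R^d1 have a countable generating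
    pi-system ([conditional_distribution_unique], [measurable_cV_rat_box]).

    A law with the mixture density is then a generalized mixture of normals only
    if its mixing law is the law of a pair (r(U, V), s(U, V)) with U and V
    independent real variables. Reweighting by the likelihood destroys the
    independence of the original U and V. Instead, the plane embeds in the line
    with a measurable left inverse ([plane_code]), so that a single variable U
    carries the pair and V can be constant ([is_GMN_of_density]).

    The normal density has total mass one in every dimension
    ([integral_mvnormal_pdf]), by induction through the same block
    factorization; this gives both the marginalization above and the existence
    of the conditional normal law. *)

(** * Positive definite matrices and Schur complements *)

Section positive_definite.
Context {R : realType}.

Lemma posdefmx_unit n (S : 'M[R]_n) : posdefmx S -> S \in unitmx.
Proof.
move=> [_ S0]; rewrite -row_free_unit; apply: inj_row_free => v vS.
apply/eqP; apply/negPn/negP => v0.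
have := S0 v^T; rewrite trmxK vS mul0mx mxE ltxx.
by rewrite trmx_eq0 v0 => /(_ isT).
Qed.

Lemma posdefmxZ n (S : 'M[R]_n) a : 0 < a -> posdefmx S -> posdefmx (a *: S).
Proof.
move=> a0 [ST S0]; split; first by rewrite linearZ/= ST.
by move=> x x0; rewrite -scalemxAr -scalemxAl mxE mulr_gt0// S0.
Qed.

Lemma posdefmx_congr n (S W : 'M[R]_n) : W \in unitmx -> posdefmx S ->
  posdefmx (W^T *m S *m W).
Proof.
move=> uW [ST S0]; split; first by rewrite !trmx_mul ST trmxK mulmxA.
move=> x x0.
rewrite (_ : x^T *m _ *m x = (W *m x)^T *m S *m (W *m x)); last first.
  by rewrite trmx_mul !mulmxA.
apply: S0; apply: contra_neq x0 => Wx.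
by rewrite -[x](mulKmx uW) Wx mulmx0.
Qed.

Lemma posdefmx_block_diag m n (A : 'M[R]_m) (D : 'M[R]_n) :
  posdefmx (block_mx A 0 0 D) -> posdefmx A /\ posdefmx D.
Proof.
move=> [+ S0]; rewrite tr_block_mx => /eq_block_mx[AT _ _ DT].
split; split => // x x0.
  have := S0 (col_mx x 0); rewrite tr_col_mx mul_row_block mul_row_col.
  rewrite !trmx0 !mul0mx !mulmx0 !addr0; apply.
  by apply: contra_neq x0 => /(congr1 usubmx); rewrite col_mxKu linear0.
have := S0 (col_mx 0 x); rewrite tr_col_mx mul_row_block mul_row_col.
rewrite !trmx0 !mul0mx !mulmx0 !add0r; apply.
by apply: contra_neq x0 => /(congr1 dsubmx); rewrite col_mxKd linear0.
Qed.

End positive_definite.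

Section schur.
Context {R : realType} (m n : nat) (S : 'M[R]_(m + n)).

(** The matrix of regression coefficients of the first block on the second. *)
Definition schur_coef : 'M[R]_(m, n) := ursubmx S *m invmx (drsubmx S).

Definition schur_compl : 'M[R]_m := ulsubmx S - schur_coef *m dlsubmx S.

Let W : 'M[R]_(m + n) := block_mx 1%:M 0 (- schur_coef^T) 1%:M.

Let WT : W^T = block_mx 1%:M (- schur_coef) 0 1%:M.
Proof. by rewrite tr_block_mx linearN/= trmxK !trmx1 trmx0. Qed.

Let det_W : \det W = 1.
Proof. by rewrite det_lblock !det1 mulr1. Qed.

Let unit_W : W \in unitmx.
Proof. by rewrite unitmxE det_W unitr1. Qed.

Hypothesis posS : posdefmx S.

Lemma posdefmx_drsubmx : posdefmx (drsubmx S).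
Proof.
have [ST S0] := posS; split; first by rewrite trmx_drsub ST.
move=> x x0; have := S0 (col_mx 0 x).
rewrite -{1}[S]submxK tr_col_mx mul_row_block mul_row_col.
rewrite !trmx0 !mul0mx !mulmx0 !add0r; apply.
by apply: contra_neq x0 => /(congr1 dsubmx); rewrite col_mxKd linear0.
Qed.

Let unit_S22 : drsubmx S \in unitmx.
Proof. exact: posdefmx_unit posdefmx_drsubmx. Qed.

(** Block Gaussian elimination: the unipotent matrix with lower left block
    minus the transpose of S12 S22^-1 diagonalizes the form by blocks. *)
Lemma schur_diag : W^T *m S *m W = block_mx schur_compl 0 0 (drsubmx S).
Proof.
have [ST _] := posS.
have ST12 : ursubmx S = (dlsubmx S)^T by rewrite trmx_dlsub ST.
have coefD : schur_coef *m drsubmx S = ursubmx S by rewrite mulmxKV.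
have Dcoef : drsubmx S *m schur_coef^T = dlsubmx S.
  have [DT _] := posdefmx_drsubmx.
  by rewrite -[in LHS]DT -trmx_mul coefD ST12 trmxK.
rewrite WT -{1}[S]submxK !mulmx_block !mul1mx !mul0mx !add0r !mulNmx coefD.
rewrite subrr !mulmx1 !mulmx0 !mul0mx !addr0 !add0r mulmxN Dcoef subrr.
by rewrite -/schur_compl.
Qed.

Lemma posdefmx_schur : posdefmx schur_compl.
Proof.
have := posdefmx_congr unit_W posS.
by rewrite schur_diag => /posdefmx_block_diag[].
Qed.

Lemma det_schur : \det S = \det (drsubmx S) * \det schur_compl.
Proof.
have := congr1 determinant schur_diag.
by rewrite !det_mulmx det_tr det_W mul1r mulr1 det_ublock mulrC.
Qed.

Lemma invmx_schur : invmx S =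
  W *m block_mx (invmx schur_compl) 0 0 (invmx (drsubmx S)) *m W^T.
Proof.
have uS := posdefmx_unit posS.
have uA := posdefmx_unit posdefmx_schur.
set D' := block_mx (invmx _) _ _ _.
have DD : block_mx schur_compl 0 0 (drsubmx S) *m D' = 1%:M.
  rewrite mulmx_block !mulmx0 !mul0mx !addr0 !add0r !mulmxV//.
  by rewrite -scalar_mx_block.
have uWT : W^T \in unitmx by rewrite unitmx_tr.
apply/esym; rewrite -[LHS](mulKmx uS) -[RHS]mulmx1; congr (_ *m _).
rewrite -[LHS](mulKmx uWT) -[RHS](mulKmx uWT); congr (_ *m _).
rewrite mulmx1 !mulmxA schur_diag DD.
by rewrite mul1mx.
Qed.

(** The inverse form splits into the inverse forms of the second diagonal block
    and of the Schur complement, evaluated at the second block and at the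
    residual of the first one. *)
Lemma schur_quadratic (z : 'cV[R]_(m + n)) :
  (z^T *m invmx S *m z) 0 0 =
  ((dsubmx z)^T *m invmx (drsubmx S) *m dsubmx z) 0 0 +
  ((usubmx z - schur_coef *m dsubmx z)^T *m invmx schur_compl *m
   (usubmx z - schur_coef *m dsubmx z)) 0 0.
Proof.
have WTz : W^T *m z = col_mx (usubmx z - schur_coef *m dsubmx z) (dsubmx z).
  by rewrite WT -{1}[z]vsubmxK mul_block_col !mul1mx mul0mx add0r mulNmx.
rewrite invmx_schur (_ : z^T *m _ *m z = (W^T *m z)^T *m
    block_mx (invmx schur_compl) 0 0 (invmx (drsubmx S)) *m (W^T *m z)).
  rewrite WTz tr_col_mx mul_row_block mul_row_col !mulmx0 addr0 add0r mxE.
  by rewrite addrC.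
by rewrite trmx_mul trmxK !mulmxA.
Qed.

End schur.

Section mvnormal_pdf.
Context {R : realType}.

(** Induction on the dimension, peeling off one row and column by a Schur
    complement, which is then a positive number. *)
Lemma det_posdefmx_gt0 n (S : 'M[R]_n) : posdefmx S -> 0 < \det S.
Proof.
elim: n S => [S _|n IH S]; first by rewrite det_mx00.
move: S; rewrite -[n.+1]/(1 + n)%N => S posS.
rewrite (det_schur posS) mulr_gt0//; first exact/IH/posdefmx_drsubmx.
rewrite det_mx11; have [_ /(_ 1%:M)] := posdefmx_schur posS.
by rewrite trmx1 mul1mx mulmx1; apply; rewrite matrix_nonzero1.
Qed.

Lemma mvnormal_pdf_ge0 n (mu : 'cV[R]_n) S x : 0 <= mvnormal_pdf mu S x.
Proof. by rewrite mulr_ge0 ?expR_ge0// invr_ge0 sqrtr_ge0. Qed.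

(** A normal density is the marginal density of the second block times the
    conditional density of the first block given the second one. *)
Lemma mvnormal_pdf_block m n (mu : 'cV[R]_(m + n)) S y : posdefmx S ->
  mvnormal_pdf mu S y =
  mvnormal_pdf (dsubmx mu) (drsubmx S) (dsubmx y) *
  mvnormal_pdf (usubmx mu + schur_coef S *m (dsubmx y - dsubmx mu))
    (schur_compl S) (usubmx y).
Proof.
move=> posS; rewrite /mvnormal_pdf.
rewrite mulrACA -expRD -invfM -sqrtrM; last first.
  rewrite mulr_ge0 ?exprn_ge0 ?mulr_ge0 ?pi_ge0//.
  exact/ltW/det_posdefmx_gt0/posdefmx_drsubmx.
congr (_^-1 * expR _).
  congr Num.sqrt; rewrite (det_schur posS) exprD [RHS]mulrACA.
  by rewrite [in RHS](mulrC (_ ^+ n)).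
rewrite schur_quadratic// -mulrDr.
have -> : dsubmx (y - mu) = dsubmx y - dsubmx mu by rewrite linearB.
have -> : usubmx (y - mu) = usubmx y - usubmx mu by rewrite linearB.
by rewrite opprD addrA.
Qed.

(** The scaled and shifted density is the standardized one up to the Jacobian
    of the affine change of variables. *)
Lemma mvnormal_pdfZ n (mu : 'cV[R]_n) S (s : R) y : 0 < s -> S \in unitmx ->
  mvnormal_pdf mu (s ^+ 2 *: S) y =
  (s^-1) ^+ n * mvnormal_pdf 0 S (s^-1 *: (y - mu)).
Proof.
move=> s0 uS; rewrite /mvnormal_pdf detZ subr0 [RHS]mulrA.
congr (_ * expR (_ * _)).
  rewrite mulrCA exprAC sqrtrM ?sqr_ge0// sqrtr_sqr ger0_norm ?exprn_ge0 ?ltW//.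
  by rewrite invfM exprVn.
have s20 : s ^+ 2 != 0 by rewrite expf_neq0// gt_eqF.
rewrite invmxZ ?unitmxZ ?unitfE// -scalemxAr -scalemxAl mxE.
have -> : (s^-1 *: (y - mu))^T = s^-1 *: (y - mu)^T by rewrite linearZ.
rewrite -!scalemxAl -scalemxAr scalerA [RHS]mxE.
by rewrite -expr2 exprVn.
Qed.

Lemma schur_coefZ m n (S : 'M[R]_(m + n)) a : a != 0 ->
  drsubmx S \in unitmx -> schur_coef (a *: S) = schur_coef S.
Proof.
move=> a0 uS.
have -> : schur_coef (a *: S) = (a *: ursubmx S) *m invmx (a *: drsubmx S).
  rewrite /schur_coef; congr (_ *m invmx _);
    by apply/matrixP => i j; rewrite !mxE.
rewrite invmxZ ?unitmxZ ?unitfE//.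
by rewrite -scalemxAl -scalemxAr scalerA mulfV// scale1r.
Qed.

Lemma schur_complZ m n (S : 'M[R]_(m + n)) a : a != 0 ->
  drsubmx S \in unitmx -> schur_compl (a *: S) = a *: schur_compl S.
Proof.
move=> a0 uS; rewrite /schur_compl schur_coefZ// scalerBr scalemxAr.
have -> : dlsubmx (a *: S) = a *: dlsubmx S.
  by apply/matrixP => i j; rewrite !mxE.
by congr (_ - _); apply/matrixP => i j; rewrite !mxE.
Qed.

End mvnormal_pdf.

(** * Densities and the Lebesgue measure on column vectors *)

Section density.
Local Open Scope ereal_scope.
Context d (T : measurableType d) (R : realType).
Variables (mu nu : {measure set T -> \bar R}) (D : set T) (f : T -> \bar R).
Hypotheses (mD : measurable D) (nuf : has_density mu D f nu).

Let mf : measurable_fun D f.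
Proof. by case: nuf. Qed.

Let f0 x : D x -> 0 <= f x.
Proof. by case: nuf => _ + _; apply. Qed.

Import HBNNSimple.

Let integral_density_nnsfun (g : {nnsfun T >-> R}) :
  \int[nu]_x (g x)%:E = \int[mu]_(x in D) ((g x)%:E * f x).
Proof.
have mg r : measurable_fun D (fun x => (r * \1_(g @^-1` [set r]) x)%:E).
  by apply/measurable_EFinP; apply: measurable_funM.
under [LHS]eq_integral do rewrite fimfunE -fsumEFin//.
under [RHS]eq_integral => x Dx.
  rewrite fimfunE -fsumEFin// ge0_mule_fsuml; last first.
    by move=> r; rewrite EFinM nnfun_muleindic_ge0.
  over.
rewrite [LHS]ge0_integral_fsum//; last 2 first.
  - by move=> r; apply/measurable_EFinP/measurable_funM.
  - by move=> r x _; rewrite EFinM nnfun_muleindic_ge0.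
rewrite [RHS]ge0_integral_fsum//; last 2 first.
  - by move=> r; exact: emeasurable_funM.
  - by move=> r x Dx; rewrite mule_ge0 ?f0// EFinM nnfun_muleindic_ge0.
apply: eq_fsbigr => r; rewrite inE => -[t _ gtr].
have r0 : (0 <= r)%R by rewrite -gtr.
under [LHS]eq_integral do rewrite EFinM.
under [RHS]eq_integral do rewrite EFinM -muleA.
rewrite ge0_integralZl//; last exact/measurable_EFinP.
rewrite ge0_integralZl//; last 2 first.
  - by apply: emeasurable_funM => //; exact/measurable_EFinP/measurable_funTS.
  - by move=> x Dx; rewrite mule_ge0 ?f0// lee_fin.
congr (_ * _); rewrite integral_indic// setIT; have [_ _ ->//] := nuf.
rewrite /density_measure setIC integral_mkcondr.
by apply: eq_integral => x _; rewrite epatch_indic/= muleC.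
Qed.

(** Integration against a measure with a density: both sides are monotone
    limits of their values on simple functions. *)
Lemma integral_density (g : T -> \bar R) : measurable_fun setT g ->
  (forall x, 0 <= g x) -> \int[nu]_x g x = \int[mu]_(x in D) (g x * f x).
Proof.
move=> mg g0; pose g_ := nnsfun_approx measurableT mg.
have g_nd x m n : (m <= n)%N -> (g_ m x)%:E <= (g_ n x)%:E.
  by move=> mn; rewrite lee_fin; exact/lefP/nd_nnsfun_approx.
have g_cvg x : (g_ n x)%:E @[n --> \oo] --> g x.
  by apply: cvg_nnsfun_approx => //= ? _; exact: g0.
transitivity (limn (fun n => \int[nu]_x (g_ n x)%:E)).
  rewrite -monotone_convergence//=.
  - by apply: eq_integral => x _; apply/esym/cvg_lim => //; exact: g_cvg.
  - by move=> n; exact/measurable_EFinP.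
  - by move=> n x _; rewrite lee_fin.
  - by move=> x _ m n; exact: g_nd.
transitivity (limn (fun n => \int[mu]_(x in D) ((g_ n x)%:E * f x))).
  by congr (limn _); apply/funext => n; exact: integral_density_nnsfun.
rewrite -monotone_convergence//=.
- apply: eq_integral => x /[!inE] Dx; apply/cvg_lim => //.
  have [gx0|gx0] := eqVneq (g x) 0.
    rewrite gx0 mul0e; apply: cvg_near_cst; apply: nearW => n /=.
    have : (g_ n x)%:E <= g x by rewrite nnsfun_approxE le_approx.
    rewrite gx0 => gn0; suff -> : (g_ n x)%:E = 0 by rewrite mul0e.
    by apply/eqP; rewrite eq_le gn0 lee_fin /=.
  have [fx0|fx0] := eqVneq (f x) 0.
    by rewrite fx0 mule0; under eq_fun do rewrite mule0; exact: cvg_cst.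
  apply: cvgeM; [|exact: g_cvg|exact: cvg_cst].
  by rewrite mule_defE negb_or !negb_and gx0 fx0.
- move=> n; apply: emeasurable_funM => //.
  exact/measurable_EFinP/measurable_funTS.
- by move=> n x Dx; rewrite mule_ge0 ?f0// lee_fin.
- by move=> x Dx m n mn; rewrite lee_wpmul2r ?f0// g_nd.
Qed.

End density.

Section lebesgue_cV_integral.
Local Open Scope ereal_scope.
Context {R : realType}.
Local Notation leb := (@lebesgue_measure R).

Lemma integral_lebesgue_cVS n (f : 'cV[R]_n.+1 -> \bar R) :
  measurable_fun setT f -> (forall x, 0 <= f x) ->
  \int[lebesgue_cV n.+1]_x f x =
  \int[leb]_a \int[lebesgue_cV n]_v f (cons_cV (a, v)).
Proof.
move=> mf f0.
have mfc := measurableT_comp mf (@measurable_cons_cV R n).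
rewrite -[LHS]/(\int[pushforward (leb \x lebesgue_cV n) (@cons_cV R n)]_x f x).
rewrite ge0_integral_pushforward//; last exact: measurable_cons_cV.
rewrite preimage_setT fubini_tonelli1// => x; exact: f0.
Qed.

Lemma measurable_col_mx m n :
  measurable_fun setT
    (fun x : 'cV[R]_m * 'cV[R]_n => col_mx x.1 x.2 : 'cV[R]_(m + n)).
Proof.
apply/measurable_fun_cVP => i; under eq_fun do rewrite mxE.
case: split_ordP => j _.
  exact: (measurableT_comp (measurable_cV_coor j)).
exact: (measurableT_comp (measurable_cV_coor j)).
Qed.

Lemma cons_col_mx m n (a : R) (v : 'cV[R]_m) (y : 'cV[R]_n) :
  cons_cV (a, col_mx v y) = col_mx (cons_cV (a, v)) y :> 'cV[R]_(m.+1 + n).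
Proof.
apply/colP => i; rewrite /cons_cV/= mxE [RHS]mxE.
case: split_ordP => j ij; case: split_ordP => k ik.
- rewrite [RHS]mxE; case: split_ordP => l kl; first by rewrite ord1 (ord1 l).
  by have := congr1 val ij; rewrite ik kl/= (ord1 j).
- by have := congr1 val ij; rewrite ik/= (ord1 j).
- rewrite mxE [RHS]mxE; case: split_ordP => l jl; case: split_ordP => p kp.
  + by have := congr1 val ij; rewrite ik kp/= (ord1 p).
  + congr (v _ _); apply: val_inj; have := congr1 val ij.
    by rewrite ik kp jl/= => -[].
  + by have := congr1 val ij; rewrite ik kp/= (ord1 p).
  + have := congr1 val ij; rewrite ik kp jl/= => -[pl].
    by have := ltn_ord p; rewrite -[val p]/(0 + p)%N pl add0n ltnNge leq_addr.
- rewrite mxE; case: split_ordP => l jl.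
  + have := congr1 val ij; rewrite ik jl/= => -[lk].
    by have := ltn_ord l; rewrite -[val l]/(0 + l)%N -lk ?add0n ltnNge leq_addr.
  + congr (y _ _); apply: val_inj; have := congr1 val ij.
    by rewrite ik jl/= => -[/addnI].
Qed.

(** Tonelli by blocks. The Lebesgue measure is built one coordinate at a time,
    so induction on the size of the first block only regroups coordinates. *)
Lemma integral_lebesgue_cVD m n (f : 'cV[R]_(m + n) -> \bar R) :
  measurable_fun setT f -> (forall x, 0 <= f x) ->
  \int[lebesgue_cV (m + n)]_x f x =
  \int[lebesgue_cV m]_x \int[lebesgue_cV n]_y f (col_mx x y).
Proof.
have mint k (g : 'cV[R]_(k + n) -> \bar R) : measurable_fun setT g ->
    (forall x, 0 <= g x) ->
    measurable_fun setT (fun x => \int[lebesgue_cV n]_y g (col_mx x y)).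
  move=> mg g0; apply: (measurable_fun_fubini_tonelli_F
    (fun z : 'cV[R]_k * 'cV[R]_n => g (col_mx z.1 z.2))) => //.
  exact: (measurableT_comp mg (@measurable_col_mx k n)).
elim: m f => [|m IH] f mf f0.
  rewrite integral_dirac//; last exact: mint.
  rewrite diracT mul1e; apply: eq_integral => y _; congr f.
  apply/colP => i; rewrite mxE; case: split_ordP => [[]//|j ->].
  by congr (y _ _); apply: val_inj.
rewrite [LHS](@integral_lebesgue_cVS (m + n) f)//.
transitivity (\int[leb]_a \int[lebesgue_cV m]_v \int[lebesgue_cV n]_y
    f (col_mx (cons_cV (a, v)) y)).
  apply: eq_integral => a _.
  have consE (v : 'cV[R]_m) (y : 'cV[R]_n) :
      cons_cV (a, col_mx v y) = col_mx (cons_cV (a, v)) y :> 'cV_(m.+1 + n).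
    exact: cons_col_mx.
  have mfa : measurable_fun setT (fun w => f (cons_cV (a, w))).
    apply: (measurableT_comp mf).
    exact: (measurableT_comp (@measurable_cons_cV R _) (pair1_measurable _)).
  rewrite [LHS](IH _ mfa (fun w => f0 _)).
  by apply: eq_integral => v _; apply: eq_integral => y _; rewrite consE.
rewrite [RHS]integral_lebesgue_cVS//; first exact: mint.
by move=> x; apply: integral_ge0.
Qed.

End lebesgue_cV_integral.

Section affine_change.
Local Open Scope ereal_scope.
Context {R : realType}.
Local Notation leb := (@lebesgue_measure R).

Let affine (m s : R) (a : measurableTypeR R) : measurableTypeR R :=
  (m + s * a)%R.

Let measurable_affine m s : measurable_fun setT (affine m s).
Proof.
by apply: measurable_funD => //; apply: measurable_funM.
Qed.

(** The image of the Lebesgue measure under an increasing affine map, rescaled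
    by the slope, gives each interval its length, hence is the Lebesgue
    measure. *)
Lemma integral_lebesgue_affine (m s : R) (f : R -> \bar R) : (0 < s)%R ->
  measurable_fun setT f -> (forall x, 0 <= f x) ->
  \int[leb]_x f x = s%:E * \int[leb]_x f (m + s * x)%R.
Proof.
move=> s0 mf f0.
pose push : {measure set (measurableTypeR R) -> \bar R} :=
  pushforward leb (affine m s).
pose mu := mscale (NngNum (ltW s0)) (push (measurable_affine m s)).
transitivity (\int[mu]_x f x).
  apply: eq_measure_integral => A mA _; apply: lebesgue_measure_unique => //.
  move=> _ [[a b] _ <-]; rewrite /mu/= /mscale/= /pushforward.
  have -> : affine m s @^-1` [set` `]a, b]] =
      [set` `](a - m) / s, (b - m) / s]]%R.
    apply/seteqP; split => x /=; rewrite !in_itv/= /affine.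
      by rewrite ltr_pdivrMr// ler_pdivlMr// mulrC ltrBlDl lerBrDl.
    by rewrite ltr_pdivrMr// ler_pdivlMr// mulrC ltrBlDl lerBrDl.
  rewrite !lebesgue_measure_itv/= !lte_fin ltr_pM2r ?invr_gt0// ltrD2r.
  case: ifPn => _; last by rewrite mule0.
  rewrite -!EFinD -EFinM; congr EFin.
  by rewrite -mulrBl mulrCA mulfV ?gt_eqF// mulr1 opprB addrA subrK.
rewrite ge0_integral_mscale//; congr (_ * _).
by rewrite ge0_integral_pushforward//= preimage_setT.
Qed.

Lemma measurable_cV_affine n (mu : 'cV[R]_n) (s : R) :
  measurable_fun setT (fun x : 'cV[R]_n => mu + s *: x)%R.
Proof.
apply/measurable_fun_cVP => i; under eq_fun do rewrite !mxE.
apply: measurable_funD => //; apply: measurable_funM => //.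
exact: measurable_cV_coor.
Qed.

Lemma integral_lebesgue_cV_affine n (mu : 'cV[R]_n) (s : R)
    (f : 'cV[R]_n -> \bar R) : (0 < s)%R ->
  measurable_fun setT f -> (forall x, 0 <= f x) ->
  \int[lebesgue_cV n]_x f x =
  (s ^+ n)%:E * \int[lebesgue_cV n]_x f (mu + s *: x)%R.
Proof.
move=> s0; elim: n mu f => [mu f mf f0|n IH mu f mf f0].
  rewrite expr0 mul1e; apply: eq_integral => x _; congr f.
  by apply/colP => -[].
have fs0 x : 0 <= f (mu + s *: x)%R by [].
have mfs := measurableT_comp mf (measurable_cV_affine mu s).
pose mu1 := (usubmx (mu : 'cV[R]_(1 + n)) 0 0)%R.
pose mu2 := dsubmx (mu : 'cV[R]_(1 + n)).
have consE a v : (mu + s *: cons_cV (a, v))%R =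
    cons_cV (mu1 + s * a, mu2 + s *: v)%R.
  apply/colP => i; rewrite /cons_cV/= !mxE.
  by case: split_ordP => j ->; rewrite /mu1 /mu2 !mxE ?ord1 ?eqxx ?mulr1n;
    reflexivity.
rewrite !integral_lebesgue_cVS//.
have mfc := measurableT_comp mf (@measurable_cons_cV R n).
have mF := measurable_fun_fubini_tonelli_F (m2 := lebesgue_cV n) _ mfc
  (fun z => f0 _).
rewrite [LHS](integral_lebesgue_affine mu1 s0 mF); last first.
  by move=> a; apply: integral_ge0 => v _; exact: f0.
rewrite exprS EFinM -muleA; congr (_ * _).
rewrite -ge0_integralZl//; last 3 first.
  - exact: (measurable_fun_fubini_tonelli_F (m2 := lebesgue_cV n)
      (fun z => f (mu + s *: cons_cV z)%R)
      (measurableT_comp mfs (@measurable_cons_cV R n)) (fun z => f0 _)).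
  - by move=> a _; apply: integral_ge0.
  - by rewrite lee_fin exprn_ge0// ltW.
apply: eq_integral => a _.
have mfa : measurable_fun setT (fun v => f (cons_cV ((mu1 + s * a)%R, v))).
  exact: (measurableT_comp mfc (pair1_measurable _)).
rewrite [LHS](IH mu2 _ mfa (fun v => f0 _)).
by congr (_ * _); apply: eq_integral => v _; rewrite consE.
Qed.

End affine_change.

(** * Normal densities *)

Section mvnormal_measure.
Context {R : realType}.
Local Notation leb := (@lebesgue_measure R).

Lemma measurable_mvnormal_pdf n (mu : 'cV[R]_n) S :
  measurable_fun setT (mvnormal_pdf mu S).
Proof.
have mc i : measurable_fun setT (fun x : 'cV[R]_n => (x - mu) i 0).
  under eq_fun do rewrite mxE.
  by apply: measurable_funD => //; exact: measurable_cV_coor.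
apply: measurable_funM => //; apply: measurableT_comp => //.
apply: measurable_funM => //; under eq_fun do rewrite mxE.
apply: measurable_sum => i; apply: measurable_funM => //.
under eq_fun do rewrite mxE; apply: measurable_sum => j.
by apply: measurable_funM => //; under eq_fun do rewrite mxE; exact: mc.
Qed.

Lemma mvnormal_pdf1E (mu : 'cV[R]_1) S (a : R) : posdefmx S ->
  mvnormal_pdf mu S a%:M = normal_pdf (mu 0 0) (Num.sqrt (S 0 0)) a.
Proof.
move=> posS.
have S0 : 0 < S 0 0 by rewrite -det_mx11 det_posdefmx_gt0.
rewrite normal_pdfE ?gt_eqF ?sqrtr_gt0//.
rewrite /mvnormal_pdf /normal_peak /normal_fun sqr_sqrtr ?ltW//.
rewrite det_mx11 expr1; congr (_^-1 * expR _).
  by congr Num.sqrt; rewrite -[RHS]mulr_natl -mulrA [pi * _]mulrC.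
rewrite {1}[S]mx11_scalar invmx_scalar mul_mx_scalar -scalemxAl mxE.
rewrite !mxE big_ord1 !mxE eqxx mulr1n -expr2.
rewrite -[S 0 0 *+ 2]mulr_natl invfM mulNr [RHS]mulNr; congr (- _).
by rewrite mulrA mulrC.
Qed.

Local Open Scope ereal_scope.

(** Induction on the dimension: by [mvnormal_pdf_block] with a first block of
    size one, integrating out the first coordinate is a Gaussian integral on
    the line, whose value does not depend on its mean and variance. *)
Lemma integral_mvnormal_pdf n (mu : 'cV[R]_n) S : posdefmx S ->
  \int[lebesgue_cV n]_x (mvnormal_pdf mu S x)%:E = 1.
Proof.
have mpdf k (m : 'cV[R]_k) C :
    measurable_fun setT (fun x => (mvnormal_pdf m C x)%:E).
  by apply/measurable_EFinP; exact: measurable_mvnormal_pdf.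
elim: n mu S => [|n IH] mu S posS.
  rewrite integral_dirac//; last exact: mpdf.
  rewrite diracT mul1e /mvnormal_pdf det_mx00.
  by rewrite expr0 mulr1 sqrtr1 invr1 mul1r mxE big_ord0 mulr0 expR0.
rewrite integral_lebesgue_cVS//; last first.
  by move=> x; rewrite lee_fin mvnormal_pdf_ge0.
have mf := measurableT_comp (mpdf _ mu S) (@measurable_cons_cV R n).
rewrite (fubini_tonelli (m2 := lebesgue_cV n) _ mf)/=; last first.
  by move=> x; rewrite lee_fin mvnormal_pdf_ge0.
pose mu' : 'cV[R]_(1 + n) := mu; pose S' : 'M[R]_(1 + n) := S.
have posS' : posdefmx S' by [].
transitivity (\int[lebesgue_cV n]_v
    (mvnormal_pdf (dsubmx mu') (drsubmx S') v)%:E); last first.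
  exact/IH/posdefmx_drsubmx.
apply: eq_integral => v _.
have blockE (a : R) : mvnormal_pdf mu S (cons_cV (a, v)) =
    (mvnormal_pdf (dsubmx mu') (drsubmx S') v * normal_pdf
      ((usubmx mu' + schur_coef S' *m (v - dsubmx mu')) 0 0)
      (Num.sqrt (schur_compl S' 0 0)) a)%R.
  rewrite -mvnormal_pdf1E; last exact: posdefmx_schur.
  rewrite -[LHS]/(mvnormal_pdf mu' S' (col_mx a%:M v)).
  rewrite (mvnormal_pdf_block mu' (col_mx a%:M v) posS').
  rewrite col_mxKu col_mxKd.
  by [].
under eq_integral do rewrite blockE EFinM.
rewrite ge0_integralZl//; first by rewrite integral_normal_pdf mule1.
- by apply/measurable_EFinP; exact: measurable_normal_pdf.
- by move=> x _; rewrite lee_fin normal_pdf_ge0.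
- by rewrite lee_fin mvnormal_pdf_ge0.
Qed.

End mvnormal_measure.

(** * Probability measures with a density, independence *)

Section density_probability.
Local Open Scope ereal_scope.
Context d (T : measurableType d) (R : realType).

Lemma density_measure_probability (mu : {measure set T -> \bar R}) (D : set T)
    (f : T -> \bar R) :
  measurable D -> measurable_fun D f -> (forall x, D x -> 0 <= f x) ->
  \int[mu]_(x in D) f x = 1 ->
  exists nu : probability T R, nu = density_measure mu D f :> (set T -> \bar R).
Proof.
move=> mD mf f0 f1.
pose g := f \_ D.
have mg : measurable_fun setT g by exact/(measurable_restrictT _ mD).
have g0 x : 0 <= g x by apply: erestrict_ge0.
have gE : density_measure mu D f = (fun A => \int[mu]_(x in A) g x).
  by apply/funext => A; rewrite /density_measure integral_mkcondr.
have g_set0 : \int[mu]_(x in set0) g x = 0 by rewrite integral_set0.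
have g_ge0 A : 0 <= \int[mu]_(x in A) g x by apply: integral_ge0.
pose M0 := isMeasure.Build _ _ _ (fun A => \int[mu]_(x in A) g x)
  g_set0 g_ge0 (semi_sigma_additive_nng_induced mg g0).
pose nu0 : {measure set T -> \bar R} :=
  HB.pack (fun A => \int[mu]_(x in A) g x) M0.
have nu01 : nu0 setT = 1 by rewrite /nu0/= -integral_mkcond.
pose M1 := Measure_isProbability.Build _ _ _ (Measure.sort nu0) nu01.
pose nu : probability T R := HB.pack (Measure.sort nu0) M1.
by exists nu; rewrite gE.
Qed.

End density_probability.

Section joint_law.
Local Open Scope ereal_scope.
Context {R : realType}.

(** Rectangles form a pi-system that generates the product sigma-algebra. *)
Lemma measure_prod_unique d1 d2 (T1 : measurableType d1)
    (T2 : measurableType d2) (m m' : {measure set (T1 * T2) -> \bar R}) :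
  m setT < +oo ->
  (forall A B, measurable A -> measurable B -> m (A `*` B) = m' (A `*` B)) ->
  forall C, measurable C -> m C = m' C.
Proof.
move=> moo mm' C mC.
apply: (measure_unique [set A `*` B | A in measurable & B in measurable]
  (fun=> setT)) => //.
- exact: measurable_prod_measurableType.
- move=> _ _ [A mA [B mB <-]] [A' mA' [B' mB' <-]].
  exists (A `&` A'); first exact: measurableI.
  by exists (B `&` B'); [exact: measurableI|rewrite setXI].
- by move=> _; exists setT => //; exists setT => //; rewrite setXTT.
- by rewrite bigcup_const.
- by move=> _ [A mA [B mB <-]]; exact: mm'.
Qed.

Context d d1 d2 d3 (T : measurableType d) (T1 : measurableType d1)
  (T2 : measurableType d2) (T3 : measurableType d3) (P : probability T R).

(** Independence of X from the pair (U, V) extends from rectangles to every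
    measurable set of pairs. *)
Lemma independent_pair (X : {RV P >-> T1}) (U : {RV P >-> T2})
    (V : {RV P >-> T3}) : mutually_independent3 X U V ->
  forall A C, measurable A -> measurable C ->
  P (X @^-1` A `&` (fun t => (U t, V t)) @^-1` C) =
  P (X @^-1` A) * P ((fun t => (U t, V t)) @^-1` C).
Proof.
move=> XUV A C mA mC.
have mXA : measurable (X @^-1` A) by exact: measurable_funPTI.
have mUV : measurable_fun setT (fun t => (U t, V t)).
  exact: measurable_fun_pair.
pose pA := fine (P (X @^-1` A)).
have pAE : P (X @^-1` A) = pA%:E by rewrite fineK// fin_num_measure.
have pA0 : (0 <= pA)%R by rewrite fine_ge0.
(* For a fixed A, both sides are finite measures in C. *)
pose push (m : {measure set T -> \bar R}) :
  {measure set (T2 * T3) -> \bar R} := pushforward m (fun t => (U t, V t)).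
pose m := push mUV (mrestr P mXA).
pose m' := mscale (NngNum pA0) (push mUV P).
have -> : P (X @^-1` A `&` (fun t => (U t, V t)) @^-1` C) = m C.
  by rewrite setIC.
rewrite pAE -[RHS]/(m' C); apply: measure_prod_unique => //.
  by rewrite /m/= /pushforward preimage_setT /mrestr setTI pAE ltry.
move=> B B' mB mB'; rewrite /m' /= /mscale/= /pushforward /mrestr -pAE.
have -> : (fun t => (U t, V t)) @^-1` (B `*` B') = U @^-1` B `&` V @^-1` B'.
  by [].
have := XUV setT B B' measurableT mB mB'.
rewrite preimage_setT setTI probability_setT mul1e => ->.
by rewrite setIC setIA XUV// muleA.
Qed.

End joint_law.

(** * The density of a generalized mixture of normals *)

Section plane_lebesgue.
Local Open Scope ereal_scope.
Context {R : realType}.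

(** The product measure under a constant of its own and over the canonical
    measurable structure of the plane, which is the one that laws of pairs of
    real random variables live on. *)
Definition lebesgue_plane : set (R * R) -> \bar R :=
  @lebesgue_measure R \x @lebesgue_measure R.

Let lebesgue_plane0 : lebesgue_plane set0 = 0.
Proof. exact: (measure0 (@lebesgue_measure R \x @lebesgue_measure R)). Qed.

Let lebesgue_plane_ge0 A : 0 <= lebesgue_plane A.
Proof. exact: (measure_ge0 (@lebesgue_measure R \x @lebesgue_measure R)). Qed.

Let lebesgue_plane_sigma_additive : semi_sigma_additive lebesgue_plane.
Proof.
exact: (@measure_semi_sigma_additive _ _ _
  (@lebesgue_measure R \x @lebesgue_measure R)).
Qed.

HB.instance Definition _ := isMeasure.Build _ _ _ lebesgue_plane
  lebesgue_plane0 lebesgue_plane_ge0 lebesgue_plane_sigma_additive.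

Let lebesgue_plane_sigma_finite : sigma_finite setT lebesgue_plane.
Proof.
have /sigma_finiteP[F [TF ndF Foo]] := sigma_finiteT (@lebesgue_measure R).
exists (fun k => F k `*` F k).
  apply/esym; rewrite -subTset => -[a b] _.
  have [i _ Fia] : (\bigcup_i F i) a by rewrite -TF.
  have [j _ Fjb] : (\bigcup_i F i) b by rewrite -TF.
  exists (maxn i j) => //; split => /=.
    by move: a Fia; exact/subsetPset/ndF/leq_maxl.
  by move: b Fjb; exact/subsetPset/ndF/leq_maxr.
move=> k; have [mF Fk] := Foo k; split; first exact: measurableX.
rewrite /lebesgue_plane product_measure1E//.
by rewrite lte_mul_pinfty// ge0_fin_numE.
Qed.

HB.instance Definition _ := Measure_isSigmaFinite.Build _ _ _ lebesgue_plane
  lebesgue_plane_sigma_finite.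

(** The plane carries two measurable structures with the same measurable sets
    but distinct displays; the identity map transports integrals. *)
Lemma integral_lebesgue_plane (D : set (R * R)) (f : R * R -> \bar R) :
  measurable D -> measurable_fun D f -> (forall p, D p -> 0 <= f p) ->
  \int[lebesgue_plane]_(p in D) f p =
  \int[@lebesgue_measure R \x @lebesgue_measure R]_(p in D) f p.
Proof.
move=> mD mf f0.
pose i (p : measurableTypeR R * measurableTypeR R) : R * R := p.
have mi : measurable_fun setT i by move=> _ A mA; rewrite setTI; exact: mA.
rewrite -[LHS]/(\int[pushforward
  (@lebesgue_measure R \x @lebesgue_measure R) i]_(p in D) f p).
by rewrite ge0_integral_pushforward// => p /[!inE]; exact: f0.
Qed.

End plane_lebesgue.

Section gmn_density.
Local Open Scope ereal_scope.
Context {R : realType}.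
Local Notation leb2 := (@lebesgue_plane R).

Definition scale_pos : set (R * R) := [set p | 0 < p.2]%R.

Lemma measurable_scale_pos : measurable scale_pos.
Proof.
rewrite (_ : scale_pos = setT `&` snd @^-1` `]0%R, +oo[%classic).
  exact: measurable_snd.
by apply/seteqP; split => p /=; rewrite in_itv/= andbT; [|case].
Qed.

(** The normal density of the mixture component with (R, S) = p. *)
Definition gmn_pdf n (xi : 'cV[R]_n) (Sigma : 'M[R]_n) (gamma : 'cV[R]_n)
    (p : R * R) (y : 'cV[R]_n) : R :=
  mvnormal_pdf (xi + p.1 *: gamma) (p.2 ^+ 2 *: Sigma) y.

Definition gmn_mix n (xi : 'cV[R]_n) (Sigma : 'M[R]_n) (gamma : 'cV[R]_n)
    (h : R * R -> \bar R) (y : 'cV[R]_n) : \bar R :=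
  \int[leb2]_(p in scale_pos) ((gmn_pdf xi Sigma gamma p y)%:E * h p).

Variables (n : nat) (xi : 'cV[R]_n) (Sigma : 'M[R]_n) (gamma : 'cV[R]_n).
Hypothesis posS : posdefmx Sigma.
Let K := gmn_pdf xi Sigma gamma.

Lemma gmn_pdf_ge0 p y : (0 <= K p y)%R.
Proof. exact: mvnormal_pdf_ge0. Qed.

Let uS : Sigma \in unitmx := posdefmx_unit posS.

Let measurable_K : measurable_fun
  [set z : 'cV[R]_n * (R * R) | scale_pos z.2] (fun z => K z.2 z.1).
Proof.
(* On the half plane the density is the standardized one composed with a map
   that is measurable everywhere; powers with exponent -1 stand for inverses. *)
pose t (z : 'cV[R]_n * (R * R)) := (z.2.2 `^ (-1))%R.
have m1 : measurable_fun setT (fun z : 'cV[R]_n * (R * R) => z.2.1).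
  exact: (measurableT_comp measurable_fst measurable_snd).
have m2 : measurable_fun setT (fun z : 'cV[R]_n * (R * R) => z.2.2).
  exact: (measurableT_comp measurable_snd measurable_snd).
have mt : measurable_fun setT t.
  exact: (measurableT_comp (measurable_powR _) m2).
pose w (z : 'cV[R]_n * (R * R)) : 'cV[R]_n :=
  (t z *: (z.1 - (xi + z.2.1 *: gamma)))%R.
have mw : measurable_fun setT w.
  apply/measurable_fun_cVP => i; under eq_fun do rewrite !mxE.
  apply: measurable_funM => //; apply: measurable_funB.
    exact: (measurableT_comp (measurable_cV_coor i)).
  by apply: measurable_funD => //; apply: measurable_funM.
have mKE : measurable_fun [set z : 'cV[R]_n * (R * R) | scale_pos z.2]
    (fun z => t z ^+ n * mvnormal_pdf 0 Sigma (w z))%R.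
  apply: measurable_funTS; apply: measurable_funM.
    exact: measurable_funX.
  exact: (measurableT_comp (measurable_mvnormal_pdf _ _)).
apply: eq_measurable_fun mKE => z /[!inE] z0.
rewrite /K /gmn_pdf mvnormal_pdfZ//.
by rewrite /w /t powR_inv1// ltW.
Qed.

Let measurable_D :
  measurable [set z : 'cV[R]_n * (R * R) | scale_pos z.2].
Proof.
rewrite -[X in measurable X]setTI -/(snd @^-1` scale_pos).
by apply: measurable_snd => //; exact: measurable_scale_pos.
Qed.

Lemma measurable_gmn_pdf_scale y : measurable_fun scale_pos (K ^~ y).
Proof.
apply: (measurable_comp measurable_D _ measurable_K
  (measurable_funTS (pair1_measurable y))).
by move=> _ [p p0 <-].
Qed.

Lemma measurable_gmn_pdf p : measurable_fun setT (K p).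
Proof. exact: measurable_mvnormal_pdf. Qed.

Variable h : R * R -> \bar R.
Hypothesis mh : measurable_fun scale_pos h.
Hypothesis h0 : forall p, scale_pos p -> 0 <= h p.

Let h' := h \_ scale_pos.

Let h'0 p : 0 <= h' p.
Proof. exact: erestrict_ge0. Qed.

Let F (z : 'cV[R]_n * (R * R)) : \bar R := (K z.2 z.1)%:E * h' z.2.

Let F0 z : 0 <= F z.
Proof. by rewrite mule_ge0// lee_fin gmn_pdf_ge0. Qed.

Lemma measurable_gmn_integrand : measurable_fun setT F.
Proof.
rewrite (_ : F = (fun z => (K z.2 z.1)%:E * h z.2) \_
    [set z : 'cV[R]_n * (R * R) | scale_pos z.2]); last first.
  apply/funext => z; rewrite /F /h' /patch.
  have -> : (z \in [set z : 'cV[R]_n * (R * R) | scale_pos z.2]) =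
    (z.2 \in scale_pos) by [].
  by case: ifPn => // _; rewrite mule0.
apply/(measurable_restrictT _ measurable_D); apply: emeasurable_funM.
  exact/measurable_EFinP.
apply: (measurable_comp measurable_scale_pos) => //.
  by move=> _ [z z0 <-].
exact: measurable_funTS.
Qed.

Lemma gmn_mixE y :
  gmn_mix xi Sigma gamma h y = \int[leb2]_p F (y, p).
Proof.
rewrite /gmn_mix integral_mkcond; apply: eq_integral => p _.
by rewrite /F /h' /patch/=; case: ifPn => // _; rewrite mule0.
Qed.

Lemma measurable_gmn_mix : measurable_fun setT (gmn_mix xi Sigma gamma h).
Proof.
rewrite (_ : gmn_mix _ _ _ _ = fun y => \int[leb2]_p F (y, p)); last first.
  by apply/funext => y; rewrite gmn_mixE.
exact: (measurable_fun_fubini_tonelli_F F measurable_gmn_integrand F0).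
Qed.

Lemma gmn_mix_ge0 y : 0 <= gmn_mix xi Sigma gamma h y.
Proof. by rewrite gmn_mixE; apply: integral_ge0 => p _; exact: F0. Qed.

(** Given the location and scale p, the law of xi + p.1 gamma + p.2 X has the
    normal density K p: affine change of variables. *)
Lemma integral_gmn_pdf p B : scale_pos p -> measurable B ->
  \int[lebesgue_cV n]_(y in B) (K p y)%:E =
  \int[lebesgue_cV n]_(x in [set x | B (xi + p.1 *: gamma + p.2 *: x)%R])
    (mvnormal_pdf 0 Sigma x)%:E.
Proof.
move=> p0 mB.
have mK := measurable_gmn_pdf p.
have mKB : measurable_fun setT ((EFin \o K p) \_ B).
  by apply/(measurable_restrictT _ mB)/measurable_funTS/measurable_EFinP.
have KB0 y : 0 <= ((EFin \o K p) \_ B) y.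
  by apply: erestrict_ge0 => z _; rewrite lee_fin gmn_pdf_ge0.
have mA := measurable_cV_affine (xi + p.1 *: gamma)%R p.2.
rewrite integral_mkcond [RHS]integral_mkcond.
rewrite (integral_lebesgue_cV_affine (xi + p.1 *: gamma)%R p0)//.
rewrite -ge0_integralZl//; last 2 first.
  - exact: (measurableT_comp mKB mA).
  - by rewrite lee_fin exprn_ge0// ltW.
apply: eq_integral => x _; rewrite /patch/=.
have -> : (x \in [set x | B (xi + p.1 *: gamma + p.2 *: x)%R]) =
  ((xi + p.1 *: gamma + p.2 *: x)%R \in B) by [].
case: ifPn => _; last by rewrite mule0.
rewrite -EFinM; congr EFin; rewrite /K /gmn_pdf mvnormal_pdfZ//.
have p20 : p.2 != 0%R by rewrite gt_eqF.
rewrite addrC addKr scalerA mulVf// scale1r mulrA.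
by rewrite -exprMn mulfV// expr1n mul1r.
Qed.

Section law.
Context d (T : measurableType d) (P : probability T R)
  (X : {RV P >-> 'cV[R]_n}) (W : {RV P >-> (R * R)%type}).
Hypothesis densX : has_density (lebesgue_cV n) setT
  (fun x => (mvnormal_pdf 0 Sigma x)%:E) (distribution P X).
Hypothesis densW : has_density leb2 scale_pos h (distribution P W).
Hypothesis indep : forall A C, measurable A -> measurable C ->
  P (X @^-1` A `&` W @^-1` C) = P (X @^-1` A) * P (W @^-1` C).

(** The joint law of ((R, S), X) is a product, so the law of
    xi + R gamma + S X is obtained by conditioning on (R, S) = p, which yields
    the normal density of parameter p, and then by Tonelli. *)
Lemma gmn_law B : measurable B ->
  P [set t | B (xi + (W t).1 *: gamma + (W t).2 *: X t)%R] =
  \int[lebesgue_cV n]_(y in B) gmn_mix xi Sigma gamma h y.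
Proof.
move=> mB.
pose g (z : (R * R) * 'cV[R]_n) : 'cV[R]_n :=
  (xi + z.1.1 *: gamma + z.1.2 *: z.2)%R.
have mg : measurable_fun setT g.
  apply/measurable_fun_cVP => i; under eq_fun do rewrite !mxE.
  apply: measurable_funD.
    apply: measurable_funD => //; apply: measurable_funM => //.
    exact: measurableT_comp.
  apply: measurable_funM; first exact: measurableT_comp.
  exact: (measurableT_comp (measurable_cV_coor i)).
have mWX : measurable_fun setT (fun t => (W t, X t)).
  exact: measurable_fun_pair.
pose J : {measure set ((R * R) * 'cV[R]_n) -> \bar R} :=
  pushforward P (fun t => (W t, X t)).
have mE : measurable (g @^-1` B).
  by rewrite -[X in measurable X]setTI; exact: mg.
rewrite -[LHS]/(J mWX (g @^-1` B)).
rewrite -(@product_measure_unique _ _ _ _ _ (distribution P W)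
  (distribution P X) (J mWX))//; last first.
  move=> C A mC mA; rewrite /J/= /pushforward.
  by rewrite muleC -indep// setIC.
rewrite [LHS](integral_density measurable_scale_pos densW)//; last first.
  exact: measurable_fun_xsection.
transitivity (\int[leb2]_p \int[lebesgue_cV n]_y
    ((fun y => F (y, p)) \_ B) y).
  rewrite integral_mkcond; apply: eq_integral => p _.
  rewrite -integral_mkcond /F/= /h' /patch/=; case: ifPn => [|_]; last first.
    by under eq_integral do rewrite mule0; rewrite integral0.
  rewrite inE => p0; rewrite ge0_integralZr//; last 3 first.
  - by apply/measurable_funTS/measurable_EFinP; exact: measurable_gmn_pdf.
  - by move=> y _; rewrite lee_fin gmn_pdf_ge0.
  - exact: h0.
  congr (_ * _); rewrite integral_gmn_pdf//.
  have [_ _ ->] := densX; last exact: measurable_xsection.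
  rewrite /density_measure setIT; congr integral.
  by apply/seteqP; split => x /=; rewrite /xsection/= inE.
rewrite -(fubini_tonelli (fun z => ((fun y => F (y, z.2)) \_ B) z.1));
  last 2 first.
- rewrite (_ : (fun z => _) = F \_ (fst @^-1` B)); last first.
    apply/funext => -[y p]; rewrite /patch/=.
    by have -> : ((y, p) \in fst @^-1` B) = (y \in B)by [].
  have mB' : measurable (fst @^-1` B : set ('cV[R]_n * (R * R))).
    by rewrite -[X in measurable X]setTI; exact: measurable_fst.
  apply/(measurable_restrictT _ mB')/measurable_funTS.
  exact: measurable_gmn_integrand.
- by move=> z; apply: erestrict_ge0.
rewrite [RHS]integral_mkcond; apply: eq_integral => y _ /=.
rewrite patchE; case: ifPn => yB.
  by rewrite gmn_mixE; apply: eq_integral => p _; rewrite patchE yB.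
by under eq_integral do rewrite patchE (negbTE yB); rewrite integral0.
Qed.

End law.

End gmn_density.

(** * Conditional distributions *)

Section conditional_uniqueness.
Local Open Scope ereal_scope.
Context d d1 d2 (T : measurableType d) (T1 : measurableType d1)
  (T2 : measurableType d2) (R : realType) (P : probability T R)
  (Y1 : {RV P >-> T1}) (Y2 : {RV P >-> T2}).

(** Almost sure uniqueness of conditional distributions: two versions agree
    almost surely on each member of a countable generating pi-system, hence
    almost surely on all of them at once. *)
Lemma conditional_distribution_unique (I : countType) (C : I -> set T1)
    (Q Q' : R.-pker T2 ~> T1) :
  measurable = <<s range C >> :> set (set T1) ->
  setI_closed (range C) -> range C setT ->
  is_conditional_distribution Y1 Y2 Q -> is_conditional_distribution Y1 Y2 Q' ->
  \forall y \ae distribution P Y2, forall A, measurable A -> Q y A = Q' y A.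
Proof.
move=> mC CI CT condQ condQ'.
have mCi i : measurable (C i) by rewrite mC; apply: sub_sigma_algebra; exists i.
have ae_i i : \forall y \ae distribution P Y2, Q y (C i) = Q' y (C i).
  have : ae_eq (distribution P Y2) setT (fun y => Q y (C i))
      (fun y => Q' y (C i)).
    apply: integral_ae_eq => //.
    - apply/integrableP; split; first exact: measurable_kernel.
      apply: (@le_lt_trans _ _ (\int[distribution P Y2]_y 1)).
        apply: ge0_le_integral => //.
        + by apply: measurableT_comp => //; exact: measurable_kernel.
        + move=> y _; rewrite gee0_abs// -(@prob_kernel _ _ _ _ _ Q y).
          by rewrite le_measure ?inE.
      rewrite integral_cst// mul1e.
      exact: le_lt_trans (probability_le1 (distribution P Y2) measurableT)
        (ltry _).
    - exact: measurable_kernel.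
    - by move=> B _ mB; rewrite -condQ// -condQ'.
  by apply: filterS => y; exact.
have := @ae_foralln _ _ _ (distribution P Y2)
  (fun n y => forall i, unpickle n = Some i -> Q y (C i) = Q' y (C i)).
have aen n : \forall y \ae distribution P Y2,
    forall i, unpickle n = Some i -> Q y (C i) = Q' y (C i).
  case: (unpickle n) => [i|]; last exact: aeW.
  by apply: filterS (ae_i i) => y QQ' _ [<-].
move=> /(_ aen); apply: filterS => y QQ' A mA.
apply: (measure_unique (range C) (fun=> setT)) => //.
- by rewrite bigcup_const.
- by move=> _ [i _ <-]; apply: (QQ' (pickle i)); rewrite pickleK.
- by move=> _; rewrite prob_kernel ltry.
Qed.

End conditional_uniqueness.

Section conditional_density.
Local Open Scope ereal_scope.
Context d d1 d2 (T : measurableType d) (T1 : measurableType d1)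
  (T2 : measurableType d2) (R : realType) (P : probability T R)
  (Y1 : {RV P >-> T1}) (Y2 : {RV P >-> T2})
  (mu1 : {sigma_finite_measure set T1 -> \bar R})
  (mu2 : {sigma_finite_measure set T2 -> \bar R})
  (f : T1 * T2 -> \bar R).
Hypothesis mf : measurable_fun setT f.
Hypothesis f0 : forall z, 0 <= f z.
Hypothesis jointE : forall A B, measurable A -> measurable B ->
  P (Y1 @^-1` A `&` Y2 @^-1` B) =
  \int[mu2]_(y in B) \int[mu1]_(x in A) f (x, y).

Definition marginal_density (y : T2) : \bar R := \int[mu1]_x f (x, y).

Let f2 := marginal_density.

(** The conditional law of Y1 given Y2 = y, before normalization. *)
Definition slice_measure (y : T2) (A : set T1) : \bar R :=
  \int[mu1]_(x in A) f (x, y).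

Let mfy y : measurable_fun setT (fun x => f (x, y)).
Proof. exact: measurable_fun_pair1. Qed.

Let slice0 y : slice_measure y set0 = 0.
Proof. exact: integral_set0. Qed.

Let slice_ge0 y A : 0 <= slice_measure y A.
Proof. by apply: integral_ge0. Qed.

Let slice_sigma_additive y : semi_sigma_additive (slice_measure y).
Proof. exact: semi_sigma_additive_nng_induced. Qed.

HB.instance Definition _ y := isMeasure.Build _ _ _ (slice_measure y)
  (slice0 y) (slice_ge0 y) (@slice_sigma_additive y).

Let slice_kernel (y : T2) : {measure set T1 -> \bar R} := slice_measure y.

Let measurable_slice A : measurable A ->
  measurable_fun setT (slice_kernel ^~ A).
Proof.
move=> mA.
have mfA : measurable_fun setT (fun z => f z * (\1_A z.1)%:E).
  apply: emeasurable_funM => //; apply/measurable_EFinP.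
  by apply: measurableT_comp => //; exact: measurable_indic.
rewrite (_ : slice_kernel ^~ A = fun y => \int[mu1]_x (f (x, y) * (\1_A x)%:E)).
  apply: (measurable_fun_fubini_tonelli_G _ mfA) => z.
  by rewrite mule_ge0// lee_fin.
apply/funext => y; rewrite /= /slice_measure integral_mkcond.
by apply: eq_integral => x _; rewrite epatch_indic.
Qed.

HB.instance Definition _ :=
  isKernel.Build _ _ _ _ _ slice_kernel measurable_slice.

Let mf2 : measurable_fun setT f2.
Proof. exact: (measurable_slice measurableT). Qed.

Let f20 y : 0 <= f2 y.
Proof. exact: integral_ge0. Qed.

Lemma marginal_density_correct : has_density mu2 setT f2 (distribution P Y2).
Proof.
split => // B mB; rewrite /density_measure setIT.
rewrite -[LHS]/(P (Y2 @^-1` B)) -(setTI (Y2 @^-1` B)).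
rewrite -[X in X `&` _](preimage_setT Y1).
by rewrite jointE.
Qed.

Let f2_total : \int[mu2]_y f2 y = 1.
Proof.
have [_ _ /(_ setT measurableT)] := marginal_density_correct.
by rewrite probability_setT /density_measure setIT => <-.
Qed.

Let f2_fin : \forall y \ae mu2, f2 y < +oo.
Proof.
have : mu2.-integrable setT f2.
  apply/integrableP; split => //.
  by under eq_integral do rewrite gee0_abs//; rewrite f2_total ltry.
move=> /(integrable_ae measurableT); apply: filterS => y /(_ I).
by rewrite fin_num_abs gee0_abs.
Qed.

(** The law of Y2 gives no mass to the zero set of its density, and this
    density is integrable, hence finite almost everywhere. *)
Lemma marginal_density_proper :
  \forall y \ae distribution P Y2, 0 < f2 y < +oo.
Proof.
have [_ _ lawE] := marginal_density_correct.
have mD : measurable [set y | 0 < f2 y < +oo].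
  rewrite (_ : [set y | _] = (setT `&` [set y | 0 < f2 y]) `&`
      (setT `&` [set y | f2 y < +oo])); last first.
    by rewrite !setTI; apply/seteqP; split => y /= /andP.
  apply: measurableI; first exact: emeasurable_fun_o_infty.
  exact: emeasurable_fun_infty_o.
exists (~` [set y | 0 < f2 y < +oo]); split => //; first exact: measurableC.
rewrite lawE; last exact: measurableC.
rewrite /density_measure setIT.
rewrite -[RHS](@integral0 _ _ _ mu2 (~` [set y | 0 < f2 y < +oo])).
apply: ge0_ae_eq_integral => //.
- exact: measurableC.
- exact: measurable_funTS.
apply: filterS f2_fin => y f2y /= /negP; rewrite f2y andbT -leNgt => f2y0.
by apply/eqP; rewrite eq_le f2y0 f20.
Qed.

(** The normalized slices form a probability kernel, with the law of Y1 as an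
    arbitrary value where the marginal density is 0 or infinite. *)
Lemma conditional_density :
  exists2 Q : R.-pker T2 ~> T1, is_conditional_distribution Y1 Y2 Q &
    forall y A, 0 < f2 y < +oo -> measurable A ->
      Q y A = \int[mu1]_(x in A) f (x, y) * (fine (f2 y))^-1%:E.
Proof.
pose Q : R.-pker T2 ~> T1 := knormalize slice_kernel (distribution P Y1).
have QE y A : 0 < f2 y < +oo -> measurable A ->
    Q y A = \int[mu1]_(x in A) f (x, y) * (fine (f2 y))^-1%:E.
  move=> /andP[f2y0 f2yoo] mA.
  rewrite /Q/= /knormalize/= /mnormalize/= /slice_kernel/= /slice_measure.
  by rewrite -/(f2 y) gt_eqF//= lt_eqF.
exists Q => // A B mA mB.
have mQA : measurable_fun setT (Q ^~ A) by exact: measurable_kernel.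
rewrite jointE// integral_mkcond [RHS]integral_mkcond.
have mQAB : measurable_fun setT ((Q ^~ A) \_ B).
  by apply/(measurable_restrictT _ mB)/measurable_funTS.
have QAB0 y : 0 <= ((Q ^~ A) \_ B) y by apply: erestrict_ge0.
rewrite [RHS](integral_density measurableT marginal_density_correct)//.
apply: ge0_ae_eq_integral => //.
- apply/(measurable_restrictT _ mB)/measurable_funTS; exact: measurable_slice.
- exact: emeasurable_funM.
- by move=> y _; apply: erestrict_ge0 => z _; exact: slice_ge0.
- by move=> y _; rewrite mule_ge0// f20.
apply: filterS f2_fin => y f2y _; rewrite /patch.
case: ifPn => _; last by rewrite mul0e.
(* Where the marginal density vanishes, the slice is the null measure. *)
have [f2y0|f2y0] := eqVneq (f2 y) 0.
  rewrite f2y0 mule0; apply/eqP; rewrite eq_le slice_ge0 andbT -f2y0.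
  exact: (le_measure (slice_kernel y) (mem_set mA) (mem_set measurableT)).
have f2yp : 0 < f2 y < +oo by rewrite f2y lt0e f2y0 f20.
rewrite QE// -[f2 y in RHS]fineK ?ge0_fin_numE// -muleA -EFinM.
by rewrite /= mulVf ?mule1// fine_eq0 ?ge0_fin_numE.
Qed.

End conditional_density.

Section countable_generation.
Context {R : realType} (n : nat).

Definition rat_box (s : seq ('I_n * rat)) : set 'cV[R]_n :=
  [set x | all (fun p => x p.1 0 <= ratr p.2) s].

Lemma rat_box_setI_closed : setI_closed (range rat_box).
Proof.
move=> _ _ [s _ <-] [t _ <-]; exists (s ++ t) => //.
by apply/seteqP; split => x; rewrite /rat_box/= all_cat => /andP.
Qed.

Lemma rat_box_setT : range rat_box setT.
Proof. by exists [::] => //; apply/seteqP; split. Qed.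

(** Rational orthants generate the Borel sets: the open half spaces with real
    bounds are countable unions of complements of rational ones. *)
Lemma measurable_cV_rat_box :
  measurable = <<s range rat_box >> :> set (set 'cV[R]_n).
Proof.
apply/seteqP; split; last first.
  apply: smallest_sub; first exact: sigma_algebra_measurable.
  move=> _ [s _ <-]; elim: s => [|[i q] s IH].
    by rewrite (_ : rat_box _ = setT)//; apply/seteqP; split.
  rewrite (_ : rat_box _ = (setT `&` (fun x : 'cV[R]_n => x i 0) @^-1`
      [set` `]-oo, ratr q]]) `&` rat_box s).
    by apply: measurableI => //; exact: measurable_cV_coor.
  apply/seteqP; split => x; rewrite /rat_box/= in_itv/=.
    by move=> /andP[].
  by move=> [[_ ->]].
pose T' := g_sigma_algebraType (range rat_box).
have mid : measurable_fun setT (id : T' -> 'cV[R]_n).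
  apply/measurable_fun_cVP => i.
  apply: (measurability _ (RGenOInfty.measurableE R)) => _ [_ [a ->] <-].
  rewrite setTI (_ : _ @^-1` _ =
      \bigcup_(q : rat) (if a <= ratr q then ~` rat_box [:: (i, q)] else set0)).
    apply: bigcupT_measurable_rat => q.
    case: ifPn => _; last exact: measurable0.
    by apply: measurableC; apply: sub_sigma_algebra; exists [:: (i, q)].
  apply/seteqP; split => x /=; rewrite in_itv/= andbT.
    move=> /rat_in_itvoo[q]; rewrite in_itv/= => /andP[aq qx].
    exists q => //; rewrite ltW// /rat_box/= andbT.
    by apply/negP; rewrite -ltNge.
  move=> [q _]; case: ifPn => // aq; rewrite /rat_box/= andbT => /negP.
  by rewrite -ltNge; exact: le_lt_trans.
by move=> A mA; have := mid measurableT A mA; rewrite setTI.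
Qed.

End countable_generation.

(** * A measurable embedding of the plane in the line *)

Section binary_code.
Context {R : realType}.

Fixpoint partial_code (n : nat) (c : nat -> bool) : R :=
  if n is n'.+1 then 4^-1 * ((c 0)%:R + partial_code n' (c \o succn)) else 0.

(** The sum of the c k / 4 ^ (k + 1). In base 4 the digits 0 and 1 determine the
    code, with no ambiguity coming from infinite expansions. *)
Definition binary_code (c : nat -> bool) : R := limn (partial_code ^~ c).

Let partial_code_bound n c : 0 <= partial_code n c <= 2^-1.
Proof.
elim: n c => [|n IH] c /=; first by rewrite lexx invr_ge0 ler0n.
have /andP[] := IH (c \o succn); case: (c 0) => /=; lra.
Qed.

Let partial_code_nd c : nondecreasing_seq (partial_code ^~ c).
Proof.
apply/nondecreasing_seqP => n; elim: n c => [|n IH] c.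
  by have /andP[] := partial_code_bound 1 c.
by rewrite /= ler_pM2l ?invr_gt0// lerD2l; exact: IH.
Qed.

Lemma cvg_binary_code c : partial_code n c @[n --> \oo] --> binary_code c.
Proof.
apply: nondecreasing_is_cvgn; first exact: partial_code_nd.
by exists 2^-1 => _ [n _ <-]; have /andP[] := partial_code_bound n c.
Qed.

Lemma binary_codeS c :
  binary_code c = 4^-1 * ((c 0)%:R + binary_code (c \o succn)).
Proof.
apply/cvg_lim => //; rewrite -cvg_shiftS/=.
by apply: cvgMr; apply: cvgD; [exact: cvg_cst|exact: cvg_binary_code].
Qed.

Lemma binary_code_bound c : 0 <= binary_code c < 1.
Proof.
apply/andP; split.
  apply: limr_ge; first exact: (cvgP _ (@cvg_binary_code c)).
  by apply: nearW => n; have /andP[] := partial_code_bound n c.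
apply: (@le_lt_trans _ _ 2^-1); last by rewrite invf_lt1// ltr1n.
apply: limr_le; first exact: (cvgP _ (@cvg_binary_code c)).
by apply: nearW => n; have /andP[] := partial_code_bound n c.
Qed.

(** The shift of the digits of a code. *)
Definition next_code (u : R) : R := if 1 <= 4 * u then 4 * u - 1 else 4 * u.

Definition code_digit (k : nat) (u : R) : bool := 1 <= 4 * iter k next_code u.

Let digit0 c : (1 <= 4 * binary_code c) = c 0.
Proof.
rewrite binary_codeS; have /andP[] := binary_code_bound (c \o succn).
by case: (c 0) => /= ? ?; [apply/idP|apply/negbTE; rewrite -ltNge]; lra.
Qed.

Lemma code_digitK k c : code_digit k (binary_code c) = c k.
Proof.
rewrite /code_digit; elim: k c => [|k IH] c; first exact: digit0.
rewrite iterSr (_ : next_code _ = binary_code (c \o succn)) ?IH//.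
rewrite /next_code digit0 binary_codeS.
by case: (c 0) => /=; lra.
Qed.

Lemma measurable_code_digit k : measurable_fun setT (code_digit k).
Proof.
have m4 : measurable_fun setT (fun u : R => 4 * u) by exact: measurable_funM.
have mnext : measurable_fun setT next_code.
  apply: measurable_fun_ifT => //; last exact: measurable_funB.
  exact: measurable_fun_ler.
have miter : measurable_fun setT (iter k next_code).
  elim: k => [|k IH]; first exact: measurable_id.
  exact: (measurableT_comp mnext IH).
apply: measurable_fun_ler => //; exact: measurable_funM.
Qed.

Lemma measurable_binary_code d (T : measurableType d) (c : nat -> T -> bool) :
  (forall k, measurable_fun setT (c k)) ->
  measurable_fun setT (fun t => binary_code (c ^~ t)).
Proof.
move=> mc.
apply: (measurable_fun_cvg (h := fun n t => partial_code n (c ^~ t))).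
  move=> n; elim: n c mc => [|n IH] c mc //=.
  apply: measurable_funM => //; apply: measurable_funD; last first.
    exact: (IH (fun k => c k.+1)).
  rewrite (_ : (fun _ => _) = fun t => if c 0 t then 1 else 0).
    exact: measurable_fun_ifT.
  by apply/funext => t; case: (c 0 t).
by move=> t _; exact: cvg_binary_code.
Qed.

End binary_code.

Section plane_code.
Context {R : realType}.

(** The cut of x in an enumeration of the rationals. *)
Definition below (k : nat) (x : R) : bool :=
  if unpickle k is Some q then (ratr q : R) < x else false.

(** The inverse of [below], total on all sequences of bits. *)
Definition cut_sup (c : nat -> bool) : R :=
  fine (ereal_sup (range (fun k =>
    if c k then if unpickle k is Some q then (ratr q : R)%:E else -oo%E
    else -oo%E))).

Lemma cut_supK x : cut_sup (below ^~ x) = x.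
Proof.
rewrite /cut_sup (_ : ereal_sup _ = x%:E)//.
apply/eqP; rewrite eq_le; apply/andP; split.
  apply: ge_ereal_sup => _ [k _ <-]; rewrite /below.
  case: (unpickle k) => [q|]; last by rewrite leNye.
  by case: ifPn => [/ltW qx|_]; rewrite ?lee_fin// leNye.
rewrite leNgt; apply/negP => supx.
have [y yx supy] : exists2 y : R, y < x &
    (ereal_sup (range (fun k => if below k x then
       if unpickle k is Some q then (ratr q : R)%:E else -oo else -oo)) <=
     y%:E)%E.
  case: (ereal_sup _) supx => [r|//|_].
    by rewrite lte_fin => rx; exists r.
  by exists (x - 1); rewrite ?leNye// ltrBlDr ltrDl.
have [q] := rat_in_itvoo yx; rewrite in_itv/= => /andP[yq qx].
have : ((ratr q : R)%:E <= y%:E)%E.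
  apply: le_trans supy; apply: ereal_sup_ubound; exists (pickle q) => //.
  by rewrite /below pickleK qx.
by rewrite lee_fin leNgt yq.
Qed.

Lemma measurable_below k : measurable_fun setT (below k).
Proof.
rewrite /below; case: (unpickle k) => [q|//].
exact: measurable_fun_ltr.
Qed.

Lemma measurable_cut_sup d (T : measurableType d) (c : nat -> T -> bool) :
  (forall k, measurable_fun setT (c k)) ->
  measurable_fun setT (fun t => cut_sup (c ^~ t)).
Proof.
move=> mc; apply: measurableT_comp => //.
pose g k t := if c k t then
  if unpickle k is Some q then (ratr q : R)%:E else -oo%E else -oo%E.
have mg k : measurable_fun setT (g k) by exact: measurable_fun_ifT.
rewrite (_ : (fun t => _) = (fun t => esups (g ^~ t) 0)).
  exact: measurable_fun_esups.
apply/funext => t; rewrite /esups/= /sdrop; congr ereal_sup.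
by apply/seteqP; split => _ [k _ <-]; exists k.
Qed.

(** The plane embeds measurably in the line with a measurable left inverse:
    the cuts of the two coordinates are interleaved. *)
Lemma plane_code : exists e : R * R -> R, exists a b : R -> R,
  [/\ measurable_fun setT e, measurable_fun setT a, measurable_fun setT b
    & cancel e (fun u => (a u, b u))].
Proof.
pose c (k : nat) (p : R * R) := below k./2 (if odd k then p.2 else p.1).
exists (fun p => binary_code (c ^~ p)).
exists (fun u => cut_sup (fun k => code_digit k.*2 u)).
exists (fun u => cut_sup (fun k => code_digit k.*2.+1 u)).
split => //.
- apply: measurable_binary_code => k; rewrite /c.
  by case: (odd k); apply: measurableT_comp (measurable_below _) _.
- by apply: measurable_cut_sup => k; exact: measurable_code_digit.
- by apply: measurable_cut_sup => k; exact: measurable_code_digit.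
move=> [x y] /=; congr pair.
  rewrite -[RHS]cut_supK; congr cut_sup; apply/funext => k.
  by rewrite code_digitK /c odd_double doubleK.
rewrite -[RHS]cut_supK; congr cut_sup; apply/funext => k.
by rewrite code_digitK /c /= odd_double uphalf_double.
Qed.

End plane_code.

(** * Generalized mixtures of normals as probability laws *)

Section gmn_existence.
Local Open Scope ereal_scope.
Context {R : realType} (n : nat).
Variables (xi : 'cV[R]_n) (Sigma : 'M[R]_n) (gamma : 'cV[R]_n).
Local Notation leb2 := (@lebesgue_plane R).

Lemma is_GMN_density (H : set (R * R) -> \bar R) nu h :
  is_GMN xi Sigma gamma H nu -> has_density leb2 (@scale_pos R) h H ->
  has_density (lebesgue_cV n) setT (gmn_mix xi Sigma gamma h) nu.
Proof.
move=> [posS [d [T [P [X [U [V [r [s [densX XUV s0 HE nuE]]]]]]]]]] [mh h0 hE].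
split; [exact: measurable_gmn_mix|by move=> y _; exact: gmn_mix_ge0|].
move=> B mB; rewrite /density_measure setIT nuE//.
have mUV : measurable_fun setT (fun t => (U t, V t)).
  exact: measurable_fun_pair.
pose w t := (r (U t, V t), s (U t, V t)).
have mw : measurable_fun setT w.
  apply: measurable_fun_pair.
    exact: (measurableT_comp (f := r) _ mUV).
  exact: (measurableT_comp (f := s) _ mUV).
pose W : {RV P >-> (R * R)%type} :=
  HB.pack w (isMeasurableFun.Build _ _ _ _ w mw).
rewrite -(@gmn_law _ _ _ _ _ posS _ mh h0 _ _ _ X W)//.
  by split => // A mA; rewrite -hE// HE.
move=> A C mA mC; have mrs : measurable_fun setT (fun z => (r z, s z)).
  exact: measurable_fun_pair.
rewrite (_ : W @^-1` C =
  (fun t => (U t, V t)) @^-1` ((fun z => (r z, s z)) @^-1` C))//.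
apply: (independent_pair XUV) => //.
by rewrite -[X in measurable X]setTI; exact: mrs.
Qed.

Lemma eq_is_GMN (H nu nu' : _ -> \bar R) :
  (forall B, measurable B -> nu B = nu' B) ->
  is_GMN xi Sigma gamma H nu -> is_GMN xi Sigma gamma H nu'.
Proof.
move=> nuE [posS [d [T [P [X [U [V [r [s [densX XUV s0 HE lawE]]]]]]]]]].
split => //; exists d, T, P, X, U, V, r, s; split => // B mB.
by rewrite -nuE// lawE.
Qed.

(** Any law of (R, S) with a density on the half plane is the law of a pair
    (r(U, V), s(U, V)) with U and V independent: encode the pair in the single
    variable U and take V constant. *)
Lemma is_GMN_of_density H h nu : posdefmx Sigma ->
  has_density leb2 (@scale_pos R) h H ->
  \int[leb2]_(p in @scale_pos R) h p = 1 ->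
  has_density (lebesgue_cV n) setT (gmn_mix xi Sigma gamma h) nu ->
  is_GMN xi Sigma gamma H nu.
Proof.
move=> posS densH0 h1 [_ _ nuE]; have [mh h0 H0E] := densH0.
have mpdf : measurable_fun setT (fun x => (mvnormal_pdf 0 Sigma x)%:E).
  by apply/measurable_EFinP; exact: measurable_mvnormal_pdf.
have [N NE] := density_measure_probability measurableT mpdf
  (fun x _ => mvnormal_pdf_ge0 0 Sigma x) (integral_mvnormal_pdf 0 posS).
have [HP HE] := density_measure_probability (@measurable_scale_pos R) mh h0 h1.
have [e [a [b [me ma mb eK]]]] := @plane_code R.
pose P : probability ('cV[R]_n * (R * R))%type R := N \x HP.
pose x_ (t : 'cV[R]_n * (R * R)) := t.1.
pose u_ (t : 'cV[R]_n * (R * R)) := e t.2.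
pose r_ (z : R * R) := a z.1.
(* The value 1 only keeps the scale positive off the half plane. *)
pose s_ (z : R * R) : R := (if 0 < b z.1 then b z.1 else 1)%R.
have mx : measurable_fun setT x_ by exact: measurable_fst.
have mu : measurable_fun setT u_ by exact: (measurableT_comp me measurable_snd).
have mr : measurable_fun setT r_ by exact: (measurableT_comp ma measurable_fst).
have ms : measurable_fun setT s_.
  have mb1 : measurable_fun setT (fun z : R * R => b z.1).
    exact: (measurableT_comp mb measurable_fst).
  by apply: measurable_fun_ifT => //; exact: measurable_fun_ltr.
pose X : {RV P >-> 'cV[R]_n} :=
  HB.pack x_ (isMeasurableFun.Build _ _ _ _ x_ mx).
pose U : {RV P >-> R} := HB.pack u_ (isMeasurableFun.Build _ _ _ _ u_ mu).
pose V : {RV P >-> R} := cst 0%R.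
pose r : {mfun (R * R)%type >-> R} :=
  HB.pack r_ (isMeasurableFun.Build _ _ _ _ r_ mr).
pose s : {mfun (R * R)%type >-> R} :=
  HB.pack s_ (isMeasurableFun.Build _ _ _ _ s_ ms).
have rsE t : scale_pos t.2 -> (r (U t, V t), s (U t, V t)) = t.2.
  move=> t0; have [a2 b2] : a (e t.2) = t.2.1 /\ b (e t.2) = t.2.2.
    by have := eK t.2; rewrite [t.2 in RHS]surjective_pairing => -[].
  rewrite /r /s /U /r_ /s_ /u_ /= a2 b2.
  by have -> : (0 < t.2.2)%R by []; rewrite -surjective_pairing.
have PE A B : measurable A -> measurable B -> P (A `*` B) = N A * HP B.
  exact: product_measure1E.
have posE : HP (@scale_pos R) = 1.
  by rewrite HE /density_measure setIid h1.
have lawW A : measurable A -> HP A =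
    P [set t | A (r (U t, V t), s (U t, V t))].
  move=> mA; set E := [set t | _].
  have mE : measurable E.
    have mw : measurable_fun setT (fun t => (r (U t, V t), s (U t, V t))).
      have mUV : measurable_fun setT (fun t => (U t, V t)).
        exact: measurable_fun_pair.
      apply: measurable_fun_pair.
        exact: (measurableT_comp (f := r) _ mUV).
      exact: (measurableT_comp (f := s) _ mUV).
    by rewrite -[E]setTI; exact: mw.
  have mD : measurable ([set: 'cV[R]_n] `*` @scale_pos R).
    exact: measurableX measurableT (@measurable_scale_pos R).
  have PD : P ([set: 'cV[R]_n] `*` @scale_pos R) = 1.
    rewrite PE//; last exact: measurable_scale_pos.
    by rewrite probability_setT mul1e posE.
  rewrite (measureDI P mE mD) [X in X + _](_ : _ = 0) ?add0e; last first.
    apply/eqP; rewrite eq_le measure_ge0 andbT.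
    have <- : P (~` ([set: 'cV[R]_n] `*` @scale_pos R)) = 0.
      by rewrite probability_setC// PD subee.
    apply: le_measure; rewrite ?inE; [exact: measurableD|exact: measurableC|].
    by move=> t [].
  have -> : E `&` ([set: 'cV[R]_n] `*` @scale_pos R) =
      setT `*` (A `&` @scale_pos R).
    apply/seteqP; split => t.
      by move=> [+ [_ t0]]; rewrite /E/= rsE.
    by move=> [_ [At t0]]; split => //; rewrite /E/= rsE.
  have mApos : measurable (A `&` @scale_pos R).
    by apply: measurableI => //; exact: measurable_scale_pos.
  apply/esym; apply: etrans (PE _ _ measurableT mApos) _.
  by rewrite probability_setT mul1e !HE /density_measure -setIA setIid.
have isG : is_GMN xi Sigma gamma H
    (fun B => P
      [set t | B (xi + r (U t, V t) *: gamma + s (U t, V t) *: X t)%R]).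
  split => //; exists _, _, P, X, U, V, r, s; split => //.
  - split => // [|A mA]; first by move=> x _; rewrite lee_fin mvnormal_pdf_ge0.
    rewrite -NE -[LHS]/(P (fst @^-1` A)) -setXT PE//.
    by rewrite probability_setT mule1.
  - move=> A B C mA mB mC.
    have meB : measurable (e @^-1` B).
      by rewrite -[X in measurable X]setTI; exact: me.
    have -> : X @^-1` A `&` U @^-1` B `&` V @^-1` C =
        (A `*` (e @^-1` B)) `&` (cst 0%R @^-1` C) by [].
    have -> : P (X @^-1` A) = N A.
      by rewrite -[LHS]/(P (fst @^-1` A)) -setXT PE// probability_setT mule1.
    have -> : P (U @^-1` B) = HP (e @^-1` B).
      rewrite -[LHS]/(P (snd @^-1` (e @^-1` B))) -setTX PE//.
      by rewrite probability_setT mul1e.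
    have -> : V @^-1` C = cst 0%R @^-1` C by [].
    rewrite preimage_cst; case: ifPn => _.
      by rewrite setIT PE// probability_setT mule1.
    by rewrite setI0 !measure0 mule0.
  - by move=> u v; rewrite /s/= /s_/=; case: ifPn.
  - by move=> A mA; rewrite H0E// -HE lawW.
have [_ _ lawE] := is_GMN_density isG densH0.
by apply: eq_is_GMN isG => B mB; rewrite lawE// nuE.
Qed.

End gmn_existence.

(** * Marginal and conditional mixtures *)

Section block_density.
Local Open Scope ereal_scope.
Context {R : realType} (d1 d2 : nat).

Lemma has_density_block (f : 'cV[R]_(d1 + d2) -> \bar R) nu :
  has_density (lebesgue_cV (d1 + d2)) setT f nu ->
  forall A B, measurable A -> measurable B ->
  nu (usubmx @^-1` A `&` dsubmx @^-1` B) =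
  \int[lebesgue_cV d2]_(y in B) \int[lebesgue_cV d1]_(x in A) f (col_mx x y).
Proof.
move=> [mf f0 nuE] A B mA mB.
set E := _ `&` _.
have mE : measurable E.
  apply: measurableI; rewrite -[X in measurable X]setTI.
    exact: measurable_usubmx.
  exact: measurable_dsubmx.
have mfE : measurable_fun setT (f \_ E).
  by apply/(measurable_restrictT _ mE)/measurable_funTS.
have fE0 y : 0 <= (f \_ E) y by apply: erestrict_ge0 => z _; exact: f0.
rewrite nuE// /density_measure setIT integral_mkcond integral_lebesgue_cVD//.
have mF := measurableT_comp mfE (@measurable_col_mx R d1 d2).
rewrite (fubini_tonelli (m1 := lebesgue_cV d1) (m2 := lebesgue_cV d2) _ mF)/=;
  last first.
  by move=> z; exact: fE0.
rewrite [RHS]integral_mkcond; apply: eq_integral => y _.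
rewrite [RHS]/patch; case: ifPn => yB.
  rewrite [RHS]integral_mkcond; apply: eq_integral => x _; rewrite /patch.
  have -> : (col_mx x y \in E) = (x \in A).
    apply/idP/idP; rewrite !inE /E/= col_mxKu col_mxKd; first by case.
    by move: yB; rewrite inE.
  by [].
have fE_eq0 x : (f \_ E) (col_mx x y) = 0.
  rewrite /patch ifF//; apply/negbTE.
  by apply: contra yB; rewrite !inE /E/= col_mxKd => -[].
by under eq_integral do rewrite fE_eq0; rewrite integral0.
Qed.

End block_density.

Section gmn_blocks.
Local Open Scope ereal_scope.
Context {R : realType} (d1 d2 : nat).
Variables (xi gamma : 'cV[R]_(d1 + d2)) (Sigma : 'M[R]_(d1 + d2)).
Hypothesis posS : posdefmx Sigma.
Local Notation leb2 := (@lebesgue_plane R).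

Let xi2 := dsubmx xi.
Let gamma2 := dsubmx gamma.
Let S22 := drsubmx Sigma.
Let xi12 (y : 'cV[R]_d2) := (usubmx xi + schur_coef Sigma *m (y - xi2))%R.
Let gamma12 := (usubmx gamma - schur_coef Sigma *m gamma2)%R.
Let S112 := schur_compl Sigma.

(** The scale cancels in the regression coefficients and factors out of the
    Schur complement, so conditioning acts on each component of the mixture with
    parameters that are again affine in (R, S). *)
Lemma gmn_pdf_block p x y : scale_pos p ->
  gmn_pdf xi Sigma gamma p (col_mx x y) =
  (gmn_pdf xi2 S22 gamma2 p y * gmn_pdf (xi12 y) S112 gamma12 p x)%R.
Proof.
move=> p0; have p20 : (0 < p.2 ^+ 2)%R by rewrite exprn_gt0.
have uS22 : drsubmx Sigma \in unitmx.
  exact: posdefmx_unit (posdefmx_drsubmx posS).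
have coefE := schur_coefZ (lt0r_neq0 p20) uS22.
have complE := schur_complZ (lt0r_neq0 p20) uS22.
rewrite /gmn_pdf mvnormal_pdf_block; last exact: posdefmxZ.
rewrite col_mxKu col_mxKd coefE complE.
have -> : drsubmx (p.2 ^+ 2 *: Sigma)%R = (p.2 ^+ 2 *: S22)%R.
  by apply/matrixP => i j; rewrite !mxE.
have -> : dsubmx (xi + p.1 *: gamma)%R = (xi2 + p.1 *: gamma2)%R.
  by apply/matrixP => i j; rewrite !mxE.
have -> : usubmx (xi + p.1 *: gamma)%R = (usubmx xi + p.1 *: usubmx gamma)%R.
  by apply/matrixP => i j; rewrite !mxE.
have -> : (usubmx xi + p.1 *: usubmx gamma +
    schur_coef Sigma *m (y - (xi2 + p.1 *: gamma2)))%R =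
    (xi12 y + p.1 *: gamma12)%R; last by [].
rewrite /xi12 /gamma12 opprD addrA mulmxDr mulmxN scalerBr -scalemxAr.
by rewrite -!addrA; congr (_ + _)%R; rewrite addrCA.
Qed.

Variable h : R * R -> \bar R.
Hypothesis mh : measurable_fun (@scale_pos R) h.
Hypothesis h0 : forall p, scale_pos p -> 0 <= h p.

Lemma measurable_gmn_mix_col_mx : measurable_fun setT
  (fun z : 'cV[R]_d1 * 'cV[R]_d2 =>
     gmn_mix xi Sigma gamma h (col_mx z.1 z.2)).
Proof.
exact: (measurableT_comp (measurable_gmn_mix _ _ posS mh h0)
  (@measurable_col_mx R d1 d2)).
Qed.

(** Integrating out the first block leaves the mixture of the marginal normal
    densities, each conditional normal density having total mass one. *)
Lemma gmn_mix_marginal y :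
  \int[lebesgue_cV d1]_x gmn_mix xi Sigma gamma h (col_mx x y) =
  gmn_mix xi2 S22 gamma2 h y.
Proof.
pose F (z : 'cV[R]_d1 * (R * R)) :=
  (gmn_pdf xi Sigma gamma z.2 (col_mx z.1 y))%:E * (h \_ (@scale_pos R)) z.2.
have mF : measurable_fun setT F.
  have mpair : measurable_fun setT
      (fun z : 'cV[R]_d1 * (R * R) => (col_mx z.1 y : 'cV[R]_(d1 + d2), z.2)).
    apply: measurable_fun_pair => //.
    have mz : measurable_fun setT (fun z : 'cV[R]_d1 * (R * R) => (z.1, y)).
      exact: measurable_fun_pair.
    exact: (measurableT_comp (@measurable_col_mx R d1 d2) mz).
  exact: (measurableT_comp (measurable_gmn_integrand xi gamma posS mh) mpair).
have F0 z : 0 <= F z.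
  by rewrite mule_ge0 ?lee_fin ?gmn_pdf_ge0//; exact: erestrict_ge0.
under eq_integral do rewrite gmn_mixE.
rewrite (fubini_tonelli (m1 := lebesgue_cV d1) (m2 := leb2) F)//.
rewrite gmn_mixE; apply: eq_integral => p _.
rewrite /F /patch/=; case: ifPn => [|_]; last first.
  by under eq_integral do rewrite mule0; rewrite integral0 mule0.
rewrite inE => p0.
under eq_integral do rewrite gmn_pdf_block// EFinM -muleA muleCA.
have pos112 : posdefmx (p.2 ^+ 2 *: S112)%R.
  by apply: posdefmxZ; [rewrite exprn_gt0|exact: posdefmx_schur].
rewrite ge0_integralZr//; last 3 first.
- by apply/measurable_EFinP; exact: measurable_mvnormal_pdf.
- by move=> x _; rewrite lee_fin gmn_pdf_ge0.
- by rewrite mule_ge0 ?h0// lee_fin gmn_pdf_ge0.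
by rewrite integral_mvnormal_pdf// mul1e.
Qed.

(** Bayes formula: the mixing density is reweighted by the likelihood of the
    second block. *)
Lemma gmn_mix_conditional x y : let f2 := gmn_mix xi2 S22 gamma2 h y in
  0 < f2 < +oo ->
  gmn_mix xi Sigma gamma h (col_mx x y) * (fine f2)^-1%:E =
  gmn_mix (xi12 y) S112 gamma12
    (fun p => (gmn_pdf xi2 S22 gamma2 p y)%:E * h p / f2) x.
Proof.
move=> f2 /andP[f20 f2oo].
have f2V : f2^-1 = (fine f2)^-1%:E.
  case: f2 f20 f2oo => [r| |]//; rewrite lte_fin inver => r0 _.
  by rewrite gt_eqF.
rewrite -[LHS]ge0_integralZr//; last 4 first.
- exact: measurable_scale_pos.
- apply: emeasurable_funM => //; apply/measurable_EFinP.
  exact: measurable_gmn_pdf_scale.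
- by move=> p p0; rewrite mule_ge0 ?h0// lee_fin gmn_pdf_ge0.
- by rewrite lee_fin invr_ge0 fine_ge0// ltW.
rewrite /gmn_mix; apply: eq_integral => p; rewrite inE => p0.
by rewrite gmn_pdf_block// EFinM f2V muleA -!muleA muleCA.
Qed.

End gmn_blocks.

(** * The conditional distribution *)

Theorem mainTheorem5 (R : realType) (d1 d2 : nat)
  (xi gamma : 'cV[R]_(d1 + d2)) (Sigma : 'M[R]_(d1 + d2))
  (H : probability (R * R)%type R) (h : R * R -> R)
  (d : measure_display) (T : measurableType d) (P : probability T R)
  (Y : {RV P >-> 'cV[R]_(d1 + d2)}) :
  let Y1 : {RV P >-> 'cV[R]_d1} := usubmx \o Y in
  let Y2 : {RV P >-> 'cV[R]_d2} := dsubmx \o Y in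
  let xi1 := usubmx xi in
  let xi2 := dsubmx xi in
  let gamma1 := usubmx gamma in
  let gamma2 := dsubmx gamma in
  let S11 := ulsubmx Sigma in
  let S12 := ursubmx Sigma in
  let S21 := dlsubmx Sigma in
  let S22 := drsubmx Sigma in
  let xi12 (y2 : 'cV[R]_d2) := xi1 + S12 *m invmx S22 *m (y2 - xi2) in
  let gamma12 := gamma1 - S12 *m invmx S22 *m gamma2 in
  let S112 := S11 - S12 *m invmx S22 *m S21 in
  let leb2 := (@lebesgue_measure R \x @lebesgue_measure R)%E in
  let RxRpos : set (R * R) := [set p | 0 < p.2] in
  let f2 (y2 : 'cV[R]_d2) : \bar R :=
    (\int[leb2]_(p in RxRpos)
       (mvnormal_pdf (xi2 + p.1 *: gamma2) (p.2 ^+ 2 *: S22) y2 * h p)%:E)%E in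
  let hc (y2 : 'cV[R]_d2) (p : R * R) : \bar R :=
    ((mvnormal_pdf (xi2 + p.1 *: gamma2) (p.2 ^+ 2 *: S22) y2 * h p)%:E
       / f2 y2)%E in
  let Hc (y2 : 'cV[R]_d2) := density_measure leb2 RxRpos (hc y2) in
  let f12 (y2 : 'cV[R]_d2) (y1 : 'cV[R]_d1) : \bar R :=
    (\int[leb2]_(p in RxRpos)
       ((mvnormal_pdf (xi12 y2 + p.1 *: gamma12) (p.2 ^+ 2 *: S112) y1)%:E
          * hc y2 p))%E in
  is_GMN xi Sigma gamma H (distribution P Y) ->
  has_density leb2 RxRpos (EFin \o h) H ->
  [/\ has_density (lebesgue_cV d2) setT f2 (distribution P Y2),
      exists Q : R.-pker 'cV[R]_d2 ~> 'cV[R]_d1,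
        is_conditional_distribution Y1 Y2 Q &
      forall Q : R.-pker 'cV[R]_d2 ~> 'cV[R]_d1,
        is_conditional_distribution Y1 Y2 Q ->
        \forall y2 \ae distribution P Y2,
          has_density (lebesgue_cV d1) setT (f12 y2) (Q y2) /\
          is_GMN (xi12 y2) S112 gamma12 (Hc y2) (Q y2)].
Proof.
move=> Y1 Y2 xi1 xi2 gamma1 gamma2 S11 S12 S21 S22 xi12 gamma12 S112.
move=> leb2 RxRpos f2 hc Hc f12 GMNY densH.
have posS : posdefmx Sigma by case: GMNY.
have posS22 : posdefmx S22 := posdefmx_drsubmx posS.
have posS112 : posdefmx S112 := posdefmx_schur posS.
have [mh h0 HE] := densH.
have mpos := @measurable_scale_pos R.
have planeE (k : R * R -> \bar R) : measurable_fun (@scale_pos R) k ->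
    (forall p, scale_pos p -> (0 <= k p)%E) ->
    forall A, measurable A ->
    density_measure (@lebesgue_plane R) (@scale_pos R) k A =
    density_measure leb2 RxRpos k A.
  move=> mk k0 A mA; apply: (integral_lebesgue_plane (measurableI _ _ mA mpos)).
    by apply: measurable_funS mk => // p [].
  by move=> p [_]; exact: k0.
have densH' : has_density (@lebesgue_plane R) (@scale_pos R) (EFin \o h) H.
  by split => // A mA; rewrite HE// planeE.
have densY := is_GMN_density GMNY densH'.
have [mf f0 _] := densY.
pose F (z : 'cV[R]_d1 * 'cV[R]_d2) :=
  gmn_mix xi Sigma gamma (EFin \o h) (col_mx z.1 z.2).
have mF : measurable_fun setT F by exact: measurable_gmn_mix_col_mx.
have F0 z : (0 <= F z)%E by exact: f0.
have jointE A B : measurable A -> measurable B ->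
    P (Y1 @^-1` A `&` Y2 @^-1` B) =
    (\int[lebesgue_cV d2]_(y in B) \int[lebesgue_cV d1]_(x in A) F (x, y))%E.
  by move=> mA mB; exact: (has_density_block densY mA mB).
pose k y p := ((gmn_pdf xi2 S22 gamma2 p y)%:E * (EFin \o h) p)%E.
have mk y : measurable_fun (@scale_pos R) (k y).
  apply: emeasurable_funM => //; apply/measurable_EFinP.
  exact: measurable_gmn_pdf_scale.
have k0 y p : scale_pos p -> (0 <= k y p)%E.
  by move=> p0; rewrite mule_ge0 ?h0// lee_fin gmn_pdf_ge0.
have f2E y : f2 y = gmn_mix xi2 S22 gamma2 (EFin \o h) y.
  exact: esym (integral_lebesgue_plane mpos (mk y) (k0 y)).
have f2E' : marginal_density (lebesgue_cV d1) F = f2.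
  by apply/funext => y; rewrite f2E; exact: gmn_mix_marginal.
have f2_proper := marginal_density_proper mF F0 jointE.
have [Q0 condQ0 Q0E] := conditional_density mF F0 jointE.
rewrite f2E' in f2_proper Q0E.
split.
- by rewrite -f2E'; exact: (marginal_density_correct mF F0 jointE).
- by exists Q0.
move=> Q condQ.
have := conditional_distribution_unique (@measurable_cV_rat_box R d1)
  (@rat_box_setI_closed R d1) (@rat_box_setT R d1) condQ condQ0.
(* The exceptional set: the marginal density is 0 or infinite, or the two
   versions Q and Q0 of the conditional distribution differ. *)
apply: filterS2 f2_proper => y f2y QQ0.
have /andP[f2y_gt0 f2y_lty] := f2y.
have f2V0 : (0 <= (f2 y)^-1)%E by rewrite inve_ge0 ltW.
have mhc : measurable_fun (@scale_pos R) (hc y).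
  exact: (emeasurable_funM (mk y) (measurable_cst (f2 y)^-1%E)).
have hc0 p : scale_pos p -> (0 <= hc y p)%E.
  by move=> p0; apply: mule_ge0 => //; exact: k0.
have f12E x : f12 y x = gmn_mix (xi12 y) S112 gamma12 (hc y) x.
  apply/esym; apply: integral_lebesgue_plane => //.
    apply: emeasurable_funM => //; apply/measurable_EFinP.
    exact: measurable_gmn_pdf_scale.
  by move=> p p0; rewrite mule_ge0 ?hc0// lee_fin gmn_pdf_ge0.
have densHc : has_density (@lebesgue_plane R) (@scale_pos R) (hc y) (Hc y).
  by split => // A mA; rewrite planeE.
have hc1 : (\int[@lebesgue_plane R]_(p in @scale_pos R) hc y p = 1)%E.
  rewrite [LHS](ge0_integralZr lebesgue_plane mpos (mk y) (k0 y) f2V0).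
  rewrite -/(gmn_mix xi2 S22 gamma2 (EFin \o h) y) -f2E.
  case: (f2 y) f2y_gt0 f2y_lty => [r| |]//; rewrite lte_fin => r0 _.
  by rewrite inver gt_eqF// -EFinM mulfV// gt_eqF.
have densQ : has_density (lebesgue_cV d1) setT (f12 y) (Q y).
  rewrite (funext f12E); split.
  - exact: measurable_gmn_mix.
  - by move=> x _; exact: gmn_mix_ge0.
  move=> A mA; rewrite /density_measure setIT QQ0// Q0E//.
  have c0 : (0 <= (fine (f2 y))^-1%:E)%E.
    by rewrite lee_fin invr_ge0 fine_ge0// ltW.
  have mFy : measurable_fun A (fun x => F (x, y)).
    by apply: measurable_funTS; exact: measurable_fun_pair1.
  apply: etrans (esym (ge0_integralZr (lebesgue_cV d1) mA mFy
    (fun x _ => F0 (x, y)) c0)) _.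
  apply: eq_integral => x _.
  have := @gmn_mix_conditional _ _ _ xi gamma _ posS _ mh h0 x y.
  by rewrite /= -f2E => /(_ f2y).
split => //; apply: is_GMN_of_density densHc hc1 _ => //.
by rewrite -(funext f12E).
Qed.
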